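(* Let $M$ be an odd-dimensional complete non-cocompact $G$-Riemannian manifold, and let $E_0\to M$ be a complex $G$-Clifford bundle with ungraded Dirac operator $D_{E_0}$. Let $P_0$ be a projection in $\mathrm{Mat}_l(C(\partial_h^G(\overline{M})))$ for some $l\ge0$, and let $P\in\mathrm{Mat}_l(C_g^{\infty,G}(M))$ be a lift of $P_0$ with $P=P^*$ and $P^2-P\in\mathrm{Mat}_l(C_0^{\infty,G}(M))$. Form the $\mathbb{Z}_2$-graded Clifford bundle $E=E_0\otimes(\mathbb{C}^l\oplus(\mathbb{C}^l)^{op})$ with Dirac operator $$D=\begin{bmatrix}0& D_{E_0}\otimes1\\ D_{E_0}\otimes1&0\end{bmatrix},$$ where $D_{E_0}\otimes 1$ is $D_{E_0}$ twisted by the trivial connection on $M\times\mathbb{C}^l$, and define $$\Phi=i\otimes\begin{bmatrix}0&1-2P\\2P-1&0\end{bmatrix}\in C^1(M,\mathrm{End}(E)).$$ Then $\Phi$ is a $G$-admissible endomorphism for $D$.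
   Context: $G$ is a Lie group. A $G$-Riemannian manifold is a Riemannian manifold on which $G$ acts smoothly, properly and isometrically. A subset of $M$ is cocompact if its image in $M/G$ has compact closure; $M$ is non-cocompact if $M/G$ is non-compact. A $G$-Clifford bundle is a $G$-equivariant Hermitian Clifford module bundle with invariant Clifford connection. $C_b^G(M)$: bounded continuous $G$-invariant functions on $M$. $C_0^G(M)$: $G$-invariant continuous functions $f$ such that for every $\epsilon>0$ there is a cocompact $M_1\subseteq M$ with $|f|<\epsilon$ on $M\setminus M_1$; $C_0^{\infty,G}(M)$ denotes its smooth elements. $C_g^{\infty,G}(M)\subset C_b^G(M)$: bounded smooth $G$-invariant functions $f$ with $\|df\|_{T^*M}\in C_0^G(M)$. $C_g^G(M)$ is the completion of $C_g^{\infty,G}(M)$ in $C_b^G(M)$ for the sup norm, and $C(\partial_h^G(\overline{M}))=C_g^G(M)/C_0^G(M)$; its maximal ideal space is the Higson $G$-corona. An odd, $G$-invariant endomorphism $\Phi\in C^1(M,\mathrm{End}\,E)$ of a $\mathbb{Z}_2$-graded $G$-Clifford bundle $E$ with Dirac operator $D$ is $G$-admissible for $D$ if (a) $\Phi D+D\Phi$ is a bounded, order-$0$ bundle endomorphism; (b) $\Phi$ is self-adjoint for the inner product on $E$; (c) there are a cocompact subset $K\subseteq M$ and $C>0$ with $\Phi D+D\Phi+\Phi^2\ge C$ on $M\setminus K$. *)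

(* Defs.v *)
From HB Require Import structures.
From mathcomp Require Import all_boot all_order all_algebra.
From mathcomp Require Import all_classical all_reals all_analysis.
From mathcomp Require Import generic_quotient complex.

Set Implicit Arguments.
Unset Strict Implicit.
Unset Printing Implicit Defensive.

Import Order.TTheory GRing.Theory Num.Theory.
Import numFieldNormedType.Exports.

Local Open Scope classical_set_scope.
Local Open Scope quotient_scope.
Local Open Scope complex_scope.
Local Open Scope ring_scope.

Notation Re := complex.Re.
Notation Im := complex.Im.

(* [U] is always open in the uses below. *)
Fixpoint Ck {R : realType} {n : nat} (k : nat) (U : set 'rV[R]_n)
    (f : 'rV[R]_n -> R) : Prop :=
  if k is k'.+1 then
    (forall x, U x -> differentiable f x) /\
    (forall v, Ck k' U (fun x => 'D_v f x))
  else forall x, U x -> {for x, continuous f}.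

Definition vderive {R : realType} {m n : nat} (v : 'rV[R]_m)
    (f : 'rV[R]_m -> 'rV[R]_n) (x : 'rV[R]_m) : 'rV[R]_n :=
  \row_i 'D_v (fun y => f y 0 i) x.

Notation ebasis i := (delta_mx 0 i : 'rV__).

Record chart (R : realType) (n : nat) (T : topologicalType) := Chart {
  cdom : set T;
  cmap : T -> 'rV[R]_n;
  cinv : 'rV[R]_n -> T;
  cdom_open : open cdom;
  cran_open : open (cmap @` cdom);
  cmapK : forall p, cdom p -> cinv (cmap p) = p;
  cmap_continuous : forall p, cdom p -> {for p, continuous cmap};
  cinv_continuous :
    forall x, (cmap @` cdom) x -> {for x, continuous cinv}
}.

(* Besides its atlas, a manifold carries a choice, at every point, of a
   preferred chart of the atlas around it.  The tangent space at [p] is R^n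
   through the preferred chart at [p]; all the structures below are required
   to be smooth in every chart, so the choice is immaterial. *)
Record manifold (R : realType) := Manifold {
  mdim : nat;
  mtop :> topologicalType;
  mhausdorff : hausdorff_space mtop;
  msecond_countable : @second_countable mtop;
  atlas : set (chart R mdim mtop);
  chart_at : mtop -> chart R mdim mtop;
  chart_at_atlas : forall p, atlas (chart_at p);
  chart_at_dom : forall p, cdom (chart_at p) p;
  atlas_compat : forall c d, atlas c -> atlas d -> forall k i,
    Ck k (cmap c @` (cdom c `&` cdom d)) (fun x => cmap d (cinv c x) 0 i)
}.
Arguments atlas {R} _.
Arguments chart_at {R m} _.

Section ManifoldCalculus.
Context {R : realType}.
Implicit Types M N Q : manifold R.

Definition tangent M (p : M) : Type := 'rV[R]_(mdim M).

Definition fCk {M} (k : nat) (U : set M) (f : M -> R) : Prop :=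
  forall c, atlas M c -> Ck k (cmap c @` (cdom c `&` U)) (f \o cinv c).

Definition cfCk {M} (k : nat) (U : set M) (f : M -> R[i]) : Prop :=
  fCk k U (fun p => Re (f p)) /\ fCk k U (fun p => Im (f p)).

Definition csmooth {M} (f : M -> R[i]) : Prop := forall k, cfCk k setT f.

Definition df {M} (f : M -> R) (p : M) (v : tangent p) : R :=
  'D_v (f \o cinv (chart_at p)) (cmap (chart_at p) p).

Definition cdf {M} (f : M -> R[i]) (p : M) (v : tangent p) : R[i] :=
  Complex (df (fun q => Re (f q)) v) (df (fun q => Im (f q)) v).

(* The coordinate vector field of the chart [c], at [p] in its domain. *)
Definition cframe {M} (c : chart R (mdim M) M) (i : 'I_(mdim M)) (p : M) :
    tangent p :=
  vderive (ebasis i) (cmap (chart_at p) \o cinv c) (cmap c p).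

(* The components of a tangent vector in the chart [c]. *)
Definition ccoord {M} (c : chart R (mdim M) M) (p : M) (v : tangent p) :
    'rV[R]_(mdim M) :=
  vderive v (cmap c \o cinv (chart_at p)) (cmap (chart_at p) p).

Definition smooth_vfield {M} (Y : forall p : M, tangent p) : Prop :=
  forall c, atlas M c -> forall k i,
    fCk k (cdom c) (fun p => ccoord c (Y p) 0 i).

Definition smooth_map {M N} (F : M -> N) : Prop :=
  continuous F /\ forall d, atlas N d -> forall k i,
    fCk k (F @^-1` cdom d) (fun p => cmap d (F p) 0 i).

Definition dmap {M N} (F : M -> N) (p : M) (v : tangent p) : tangent (F p) :=
  vderive v (cmap (chart_at (F p)) \o F \o cinv (chart_at p))
    (cmap (chart_at p) p).

(* Functions and maps on the product manifold M x N, whose atlas consists of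
   the products of charts. *)
Definition fCk2 {M N} (k : nat) (W : set (M * N)) (f : M * N -> R) : Prop :=
  forall c d, atlas M c -> atlas N d ->
    Ck k ((fun z : M * N => row_mx (cmap c z.1) (cmap d z.2)) @`
            (W `&` (cdom c `*` cdom d)))
      (fun x => f (cinv c (lsubmx x), cinv d (rsubmx x))).

Definition cfCk2 {M N} (k : nat) (W : set (M * N)) (f : M * N -> R[i]) :
    Prop :=
  fCk2 k W (fun z => Re (f z)) /\ fCk2 k W (fun z => Im (f z)).

Definition smooth_map2 {M N Q} (F : M * N -> Q) : Prop :=
  continuous F /\ forall d, atlas Q d -> forall k i,
    fCk2 k (F @^-1` cdom d) (fun z => cmap d (F z) 0 i).

End ManifoldCalculus.

Record lieGroup (R : realType) := LieGroup {
  lman :> manifold R;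
  lmul : lman -> lman -> lman;
  lone : lman;
  linv : lman -> lman;
  lmulA : associative lmul;
  lmul1 : left_id lone lmul;
  lmulV : left_inverse lone linv lmul;
  lmul_smooth : smooth_map2 (fun z => lmul z.1 z.2);
  linv_smooth : smooth_map linv
}.
Arguments lone {R l}.

Record riemannian (R : realType) := Riemannian {
  rman :> manifold R;
  gmet : forall p : rman, 'M[R]_(mdim rman);
  gip := fun (p : rman) (v w : tangent p) => (v *m gmet p *m w^T) 0 0 : R;
  gmet_sym : forall p, (gmet p)^T = gmet p;
  gmet_pos : forall p (v : tangent p), v != 0 -> 0 < gip v v;
  gmet_smooth : forall c, atlas rman c -> forall k i j,
    fCk k (cdom c) (fun p => gip (cframe c i p) (cframe c j p))
}.

Section RiemannianGeometry.
Context {R : realType} {M : riemannian R}.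

Definition conorm2 (p : M) (a : tangent p -> R) : R :=
  \sum_i \sum_j invmx (gmet p) i j * a (ebasis i) * a (ebasis j).

Definition cdf_norm (f : M -> R[i]) (p : M) : R :=
  Num.sqrt (conorm2 (@df _ M (fun q => Re (f q)) p) +
            conorm2 (@df _ M (fun q => Im (f q)) p)).

Definition velocity (c : R -> M) (t : R) : tangent (c t) :=
  \row_i derive1 (fun s => cmap (chart_at (c t)) (c s) 0 i) t.

Definition C1_curve (c : R -> M) : Prop :=
  continuous c /\ forall d, atlas M d -> forall t, cdom d (c t) -> forall i,
    derivable (fun s => cmap d (c s) 0 i) t 1 /\
    {for t, continuous (derive1 (fun s => cmap d (c s) 0 i))}.

Definition curve_length (c : R -> M) : \bar R :=
  (\int[lebesgue_measure]_(t in `[0%R, 1%R])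
     (Num.sqrt (gip (velocity c t) (velocity c t)))%:E)%E.

(* Infinite between points of different components. *)
Definition rdist (p q : M) : \bar R :=
  ereal_inf [set curve_length c | c in
    [set c | C1_curve c /\ c 0 = p /\ c 1 = q]].

Definition rcomplete : Prop := forall u : nat -> M,
  (forall e : R, 0 < e -> exists N, forall m n, (N <= m)%N -> (N <= n)%N ->
     (rdist (u m) (u n) < e%:E)%E) ->
  exists p, forall e : R, 0 < e -> exists N, forall n, (N <= n)%N ->
     (rdist (u n) p < e%:E)%E.

(* The metric near [p] in the preferred chart at [p]. *)
Definition gmet_at (p : M) (x : 'rV[R]_(mdim M)) : 'M[R]_(mdim M) :=
  let q := cinv (chart_at p) x in
  \matrix_(i, j) gip (cframe (chart_at p) i q) (cframe (chart_at p) j q).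

Definition dgmet (p : M) (u : tangent p) : 'M[R]_(mdim M) :=
  \matrix_(i, j) 'D_u (fun x => gmet_at p x i j) (cmap (chart_at p) p).

(* Gamma(v, w)^k
     = 1/2 g^{kl} (v(g_{lm}) w^m + w(g_{lm}) v^m - d_l g_{ij} v^i w^j). *)
Definition christoffel (p : M) (v w : tangent p) : tangent p :=
  2^-1 *: ((\row_l ((w *m dgmet v) 0 l + (v *m dgmet w) 0 l
                    - (v *m dgmet (ebasis l : tangent p) *m w^T) 0 0))
           *m invmx (gmet p)).

Definition levi_civita (Y : forall p : M, tangent p) (p : M) (v : tangent p) :
    tangent p :=
  let c := chart_at p in
  vderive v (fun x => ccoord c (Y (cinv c x))) (cmap c p)
  + christoffel v (Y p).

End RiemannianGeometry.
Arguments rcomplete {R} M.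

Record gRiemannian (R : realType) (G : lieGroup R) := GRiemannian {
  grman :> riemannian R;
  act : G -> grman -> grman;
  act1 : forall p, act lone p = p;
  actM : forall g h p, act (lmul g h) p = act g (act h p);
  act_smooth : smooth_map2 (fun z => act z.1 z.2);
  act_proper : forall K : set (grman * grman), compact K ->
    compact ((fun z : G * grman => (z.2, act z.1 z.2)) @^-1` K);
  act_isometric : forall g p (v w : tangent p),
    gip (dmap (act g) v) (dmap (act g) w) = gip v w
}.

Section OrbitSpace.
Context {R : realType} {G : lieGroup R} (M : gRiemannian G).

Definition same_orbit : rel M := fun p q => `[< exists g : G, q = act g p >].

Lemma same_orbit_refl : reflexive same_orbit.
Proof. by move=> p; apply/asboolP; exists lone; rewrite act1. Qed.

Lemma same_orbit_sym : symmetric same_orbit.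
Proof.
have H p q : same_orbit p q -> same_orbit q p.
  move=> /asboolP[g ->]; apply/asboolP; exists (linv g).
  by rewrite -actM lmulV act1.
by move=> p q; apply/idP/idP; exact: H.
Qed.

Lemma same_orbit_trans : transitive same_orbit.
Proof.
move=> q p r /asboolP[g ->] /asboolP[h ->]; apply/asboolP.
by exists (lmul h g); rewrite actM.
Qed.

Canonical orbit_equiv :=
  EquivRel same_orbit same_orbit_refl same_orbit_sym same_orbit_trans.

Definition orbit_space := quotient_topology {eq_quot orbit_equiv}.

Definition orbit_proj (p : M) : orbit_space :=
  \pi_orbit_space p.

Definition cocompact (A : set M) : Prop :=
  compact (closure (orbit_proj @` A)).

Definition non_cocompact : Prop := ~ compact [set: orbit_space].

Definition invariant {T : Type} (f : M -> T) : Prop :=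
  forall (g : G) p, f (act g p) = f p.

Definition ccontinuous (f : M -> R[i]) : Prop :=
  continuous (fun p => Re (f p)) /\ continuous (fun p => Im (f p)).

Definition cbounded (f : M -> R[i]) : Prop :=
  exists c : R, forall p, `|f p| <= c%:C.

Definition CbG : set (M -> R[i]) :=
  [set f | [/\ ccontinuous f, cbounded f & invariant f]].

Definition C0G : set (M -> R[i]) :=
  [set f | [/\ ccontinuous f, invariant f &
    forall e : R, 0 < e -> exists M1 : set M, cocompact M1 /\
      forall p, ~ M1 p -> `|f p| < e%:C]].

Definition C0smoothG : set (M -> R[i]) :=
  [set f | C0G f /\ csmooth f].

Definition CgsmoothG : set (M -> R[i]) :=
  [set f | [/\ CbG f, csmooth f & C0G (fun p => (cdf_norm f p)%:C)]].

(* The completion of [CgsmoothG] inside [CbG] for the sup norm, i.e. its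
   uniform closure. *)
Definition CgG : set (M -> R[i]) :=
  [set f | CbG f /\ forall e : R, 0 < e ->
    exists2 h, CgsmoothG h & forall p, `|f p - h p| <= e%:C].

End OrbitSpace.
Arguments non_cocompact {R G} M.

(* As C_0^G(M) is contained in C_g^G(M), which is contained in C_b^G(M), the
   quotient is realized as the set [CcoronaG] of the classes of the elements
   of C_g^G(M) in the ring C_b^G(M) / C_0^G(M). *)
Section CoronaAlgebra.
Context {R : realType} {G : lieGroup R} (M : gRiemannian G).

Definition CbG_pred : {pred M -> R[i]} := fun f => `[< CbG f >].

Lemma CbG_subring : subring_closed CbG_pred.
Proof.
have E (A B : R[i]) : (Re (A - B) = Re A - Re B) * (Im (A - B) = Im A - Im B).
  by case: A B => [? ?] [? ?].
have F (A B : R[i]) : (Re (A * B) = Re A * Re B - Im A * Im B) *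
    (Im (A * B) = Re A * Im B + Im A * Re B).
  by case: A B => [? ?] [? ?].
split.
- apply/asboolP; split => //.
  + by split; exact: cst_continuous.
  + by exists 1 => p; rewrite normr1.
- move=> f g /asboolP[[fr fi] [a fa] fG] /asboolP[[gr gi] [b gb] gG].
  apply/asboolP; split.
  + split.
      rewrite [X in continuous X](_ : _ = (fun p => Re (f p) - Re (g p))).
        by move=> p; apply: cvgB; [exact: fr | exact: gr].
      by apply/funext => p; rewrite E.
    rewrite [X in continuous X](_ : _ = (fun p => Im (f p) - Im (g p))).
      by move=> p; apply: cvgB; [exact: fi | exact: gi].
    by apply/funext => p; rewrite E.
  + exists (a + b) => p; rewrite rmorphD /=.
    by apply: le_trans (ler_normB _ _) _; exact: lerD.
  + by move=> h p; rewrite /= -[LHS]/(f _ - g _) fG gG.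
- move=> f g /asboolP[[fr fi] [a fa] fG] /asboolP[[gr gi] [b gb] gG].
  apply/asboolP; split.
  + split.
      rewrite [X in continuous X](_ : _ =
          (fun p => Re (f p) * Re (g p) - Im (f p) * Im (g p))).
        by move=> p; apply: cvgB; apply: cvgM; [exact: fr | exact: gr |
          exact: fi | exact: gi].
      by apply/funext => p; rewrite F.
    rewrite [X in continuous X](_ : _ =
        (fun p => Re (f p) * Im (g p) + Im (f p) * Re (g p))).
      by move=> p; apply: cvgD; apply: cvgM; [exact: fr | exact: gi |
        exact: fi | exact: gr].
    by apply/funext => p; rewrite F.
  + exists (a * b) => p; rewrite -[(f * g) p]/(f p * g p) normrM rmorphM /=.
    exact: ler_pM.
  + by move=> h p; rewrite -[LHS]/(f _ * g _) fG gG.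
Qed.

Lemma CbG_predP (f : M -> R[i]) : reflect (CbG f) (f \in CbG_pred).
Proof. exact: asboolP. Qed.

HB.instance Definition _ :=
  GRing.isSubringClosed.Build (M -> R[i]) CbG_pred CbG_subring.

Record CbG_alg := CbGAlg { CbG_fun :> M -> R[i]; _ : CbG_fun \in CbG_pred }.
HB.instance Definition _ := [isSub for CbG_fun].
HB.instance Definition _ := [Choice of CbG_alg by <:].
HB.instance Definition _ := GRing.SubChoice_isSubComPzRing.Build (M -> R[i]) CbG_pred CbG_alg
  CbG_subring.

Lemma CbG_algP (f : CbG_alg) : CbG f.
Proof. by case: f => f fP; apply/CbG_predP. Qed.

Lemma cocompactU (A B : set M) : cocompact A -> cocompact B ->
  cocompact (A `|` B).
Proof. by rewrite /cocompact image_setU closureU; exact: compactU. Qed.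

Lemma C0G_cst0 : C0G (0 : M -> R[i]).
Proof.
split=> [|//|e e0]; first by split; exact: cst_continuous.
exists set0; split; last by move=> p _; rewrite normr0 ltcR.
by rewrite /cocompact image_set0 closure0; exact: compact0.
Qed.

Lemma C0GB (f g : M -> R[i]) : CbG f -> CbG g -> C0G f -> C0G g -> C0G (f - g).
Proof.
move=> fb gb [_ _ f0] [_ _ g0].
have [fgc _ fgi] : CbG (f - g) by apply/CbG_predP/rpredB; exact/CbG_predP.
split=> // e e0.
have e2 : 0 < e / 2 by rewrite divr_gt0.
have [A [cA fA]] := f0 _ e2; have [B [cB gB]] := g0 _ e2.
exists (A `|` B); split; first exact: cocompactU.
move=> p AB; rewrite [e]splitr rmorphD /=.
apply: le_lt_trans (ler_normB _ _) _.
by apply: ltrD; [apply: fA|apply: gB] => ?; apply: AB; [left|right].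
Qed.

Lemma C0GM (f g : M -> R[i]) : CbG f -> CbG g -> C0G g -> C0G (f * g).
Proof.
move=> fb gb [_ _ g0]; have [_ [a fa] _] := fb.
have [fgc _ fgi] : CbG (f * g) by apply/CbG_predP/rpredM; exact/CbG_predP.
split=> // e e0.
have a1 : 0 < `|a| + 1 by rewrite ltr_wpDl.
have ea : 0 < e / (`|a| + 1) by rewrite divr_gt0.
have [A [cA gA]] := g0 _ ea; exists A; split=> // p pA.
rewrite -[(f * g) p]/(f p * g p) normrM.
have fa' : `|f p| <= (`|a| + 1)%:C.
  apply: le_trans (fa p) _; rewrite lecR.
  by apply: le_trans (ler_norm _) _; rewrite lerDl.
apply: le_lt_trans (ler_wpM2r _ fa') _ => //.
have -> : e%:C = (`|a| + 1)%:C * (e / (`|a| + 1))%:C.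
  by rewrite -rmorphM /= mulrC divfK ?lt0r_neq0.
by rewrite ltr_pM2l; [exact: gA | rewrite ltcR].
Qed.

Lemma C0G_alg0 : C0G (0 : CbG_alg).
Proof. exact: C0G_cst0. Qed.

Lemma C0G_algB (f g : CbG_alg) : C0G f -> C0G g -> C0G (f - g : CbG_alg).
Proof. by move=> f0 g0; exact: (C0GB (CbG_algP f) (CbG_algP g) f0 g0). Qed.

Lemma C0G_algN (f : CbG_alg) : C0G f -> C0G (- f : CbG_alg).
Proof. by rewrite -sub0r; apply: C0G_algB; exact: C0G_alg0. Qed.

Lemma C0G_algD (f g : CbG_alg) : C0G f -> C0G g -> C0G (f + g : CbG_alg).
Proof.
by move=> f0 g0; rewrite -[g]opprK; apply: C0G_algB => //; exact: C0G_algN.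
Qed.

Lemma C0G_algM (f g : CbG_alg) : C0G g -> C0G (f * g : CbG_alg).
Proof. by move=> g0; exact: (C0GM (CbG_algP f) (CbG_algP g) g0). Qed.

Definition corona_rel : rel CbG_alg := fun f g => `[< C0G (f - g : CbG_alg) >].

Lemma corona_relE (f g : CbG_alg) : corona_rel f g <-> C0G (f - g : CbG_alg).
Proof. by split => /asboolP. Qed.

Lemma corona_refl : reflexive corona_rel.
Proof. by move=> f; apply/corona_relE; rewrite subrr; exact: C0G_alg0. Qed.

Lemma corona_sym : symmetric corona_rel.
Proof.
have H (f g : CbG_alg) : corona_rel f g -> corona_rel g f.
  move=> /corona_relE fg; apply/corona_relE; rewrite -opprB.
  exact: C0G_algN.
by move=> f g; apply/idP/idP; exact: H.
Qed.

Lemma corona_trans : transitive corona_rel.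
Proof.
move=> g f h /corona_relE fg; rewrite corona_sym => /corona_relE hg.
apply/corona_relE; have -> : f - h = (f - g) - (h - g).
  by rewrite opprB addrA subrK.
exact: C0G_algB.
Qed.

Canonical corona_equiv :=
  EquivRel corona_rel corona_refl corona_sym corona_trans.
Definition corona_ring := {eq_quot corona_equiv}.
HB.instance Definition _ := Choice.on corona_ring.
HB.instance Definition _ := EqQuotient.on corona_ring.

Definition corona_class (f : CbG_alg) : corona_ring := \pi_corona_ring f.

Lemma corona_classP (f g : CbG_alg) :
  corona_class f = corona_class g <-> C0G (f - g : CbG_alg).
Proof.
rewrite -corona_relE; split=> [fg|fg]; first exact/(@eqquotP _ corona_equiv corona_ring).
exact/(@eqquotP _ corona_equiv corona_ring).
Qed.

Definition corona_add (x y : corona_ring) := corona_class (repr x + repr y).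
Definition corona_opp (x : corona_ring) := corona_class (- repr x).
Definition corona_mul (x y : corona_ring) := corona_class (repr x * repr y).

Lemma corona_reprK (x : corona_ring) : corona_class (repr x) = x.
Proof. exact: reprK. Qed.

Lemma corona_repr (f : CbG_alg) : C0G (repr (corona_class f) - f : CbG_alg).
Proof. by apply/corona_classP; rewrite corona_reprK. Qed.

Lemma corona_addE (f g : CbG_alg) :
  corona_add (corona_class f) (corona_class g) = corona_class (f + g).
Proof.
by apply/corona_classP; rewrite opprD addrACA; apply: C0G_algD;
  exact: corona_repr.
Qed.

Lemma corona_oppE (f : CbG_alg) : corona_opp (corona_class f) = corona_class (- f).
Proof.
apply/corona_classP; rewrite -opprD.
by apply: C0G_algN; exact: corona_repr.
Qed.

Lemma corona_mulE (f g : CbG_alg) :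
  corona_mul (corona_class f) (corona_class g) = corona_class (f * g).
Proof.
apply/corona_classP; set f' := repr _; set g' := repr _.
have -> : f' * g' - f * g = f' * (g' - g) + g * (f' - f).
  by rewrite !mulrBr (mulrC g f') (mulrC g f) addrA subrK.
apply: C0G_algD; apply: C0G_algM; exact: corona_repr.
Qed.

Let addA : associative corona_add.
Proof.
move=> x y z; rewrite -[x]corona_reprK -[y]corona_reprK -[z]corona_reprK.
by rewrite !corona_addE addrA.
Qed.
Let addC : commutative corona_add.
Proof. by move=> x y; rewrite /corona_add addrC. Qed.
Let add0 : left_id (corona_class 0) corona_add.
Proof. by move=> x; rewrite -[x]corona_reprK corona_addE add0r. Qed.
Let addN : left_inverse (corona_class 0) corona_opp corona_add.
Proof.
by move=> x; rewrite -[x]corona_reprK corona_oppE corona_addE addNr.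
Qed.
HB.instance Definition _ :=
  GRing.isZmodule.Build corona_ring addA addC add0 addN.

Let mulA : associative corona_mul.
Proof.
move=> x y z; rewrite -[x]corona_reprK -[y]corona_reprK -[z]corona_reprK.
by rewrite !corona_mulE mulrA.
Qed.
Let mulC : commutative corona_mul.
Proof. by move=> x y; rewrite /corona_mul mulrC. Qed.
Let mul1 : left_id (corona_class 1) corona_mul.
Proof. by move=> x; rewrite -[x]corona_reprK corona_mulE mul1r. Qed.
Let mulDl : left_distributive corona_mul +%R.
Proof.
move=> x y z; rewrite -[x]corona_reprK -[y]corona_reprK -[z]corona_reprK.
rewrite -[X in corona_mul X]/(corona_add _ _) -[RHS]/(corona_add _ _).
by rewrite !(corona_mulE, corona_addE) mulrDl.
Qed.
HB.instance Definition _ :=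
  GRing.Zmodule_isComPzRing.Build corona_ring mulA mulC mul1 mulDl.

Lemma normc_conj (z : R[i]) : `|z^*| = `|z|.
Proof. by rewrite !normcE conjcK mulrC. Qed.

Lemma CbG_conj (f : M -> R[i]) : CbG f -> CbG (fun p => (f p)^*).
Proof.
move=> [[fr fi] [a fa] fG]; split.
- split.
    by rewrite [X in continuous X](_ : _ = (fun p => Re (f p))) //;
      apply/funext => p; case: (f p).
  rewrite [X in continuous X](_ : _ = (fun p => - Im (f p))).
    by move=> p; apply: cvgN; exact: fi.
  by apply/funext => p; case: (f p).
- by exists a => p; rewrite normc_conj; exact: fa.
- by move=> g p; rewrite fG.
Qed.

Definition CbG_star (f : CbG_alg) : CbG_alg :=
  CbGAlg (introT (CbG_predP _) (CbG_conj (CbG_algP f))).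

Definition corona_star (x : corona_ring) : corona_ring :=
  corona_class (CbG_star (repr x)).

Lemma corona_starE (f : CbG_alg) :
  corona_star (corona_class f) = corona_class (CbG_star f).
Proof.
apply/corona_classP; have [[hr hi] hG h0] := corona_repr f.
have <- : CbG_star (repr (corona_class f) - f) =
    CbG_star (repr (corona_class f)) - CbG_star f.
  by apply: val_inj; apply/funext => p /=; exact: rmorphB.
have [cc _ _] := CbG_conj (CbG_algP (repr (corona_class f) - f)).
split=> [//|g p|e e0]; first exact: (congr1 conjc (hG g p)).
have [A [cA hA]] := h0 e e0; exists A; split=> // p pA.
by rewrite [X in `|X|](_ : _ = (val (repr (corona_class f) - f) p)^*) //
  normc_conj; exact: hA.
Qed.

Definition CcoronaG : set corona_ring :=
  [set corona_class f | f in [set f : CbG_alg | CgG f]].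

Definition corona_lift (f : M -> R[i]) (x : corona_ring) : Prop :=
  exists2 h : CbG_alg, CbG_fun h = f & corona_class h = x.

End CoronaAlgebra.
Arguments CcoronaG {R G} M.

Section Frames.
Context {R : realType} {M : manifold R}.

Record lframe (E : M -> lmodType R[i]) := LFrame {
  ldom : set M;
  lix : finType;
  lsec : lix -> forall p, E p;
  ldom_open : open ldom;
  lbasis : forall p, ldom p -> forall v : E p,
    exists! a : {ffun lix -> R[i]}, v = \sum_i a i *: lsec i p
}.

Arguments lsec {E} l i p : rename.

(* The section [s] has C^k coefficients in the frame [f] over [U]. *)
Definition frameCk {E : M -> lmodType R[i]} (f : lframe E) (k : nat)
    (U : set M) (s : forall p, E p) : Prop :=
  exists a : lix f -> M -> R[i],
    (forall i, cfCk k (U `&` ldom f) (a i)) /\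
    (forall p, U p -> ldom f p -> s p = \sum_i a i p *: lsec f i p).

End Frames.
Arguments lsec {R M E} l i p : rename.

Record hbundle (R : realType) (M : manifold R) := HBundle {
  fib :> M -> lmodType R[i];
  frames : lframe fib -> Prop;
  frames_cover : forall p, exists2 f, frames f & ldom f p;
  frames_compat : forall f f', frames f -> frames f' -> forall k j,
    frameCk f' k (ldom f) (lsec f j);
  herm : forall p, fib p -> fib p -> R[i];
  herm_linear : forall p a (u v w : fib p),
    herm (a *: u + v) w = a * herm u w + herm v w;
  herm_conj : forall p (u v : fib p), herm v u = (herm u v)^*;
  herm_pos : forall p (u : fib p), u != 0 -> 0 < herm u u;
  herm_smooth : forall f, frames f -> forall k i j,
    cfCk k (ldom f) (fun p => herm (lsec f i p) (lsec f j p))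
}.

Arguments frames {R M} h f.

Section Sections.
Context {R : realType} {M : manifold R} (E : hbundle M).

Definition section := forall p : M, E p.

Definition endo := forall p : M, E p -> E p.

Definition secCk (k : nat) (s : section) : Prop :=
  forall f, frames E f -> frameCk f k setT s.

Definition fib_linear {V W : lmodType R[i]} (T : V -> W) : Prop :=
  forall a u v, T (a *: u + v) = a *: T u + T v.

Definition endoCk (k : nat) (T : endo) : Prop :=
  (forall p, fib_linear (T p)) /\
  (forall f, frames E f -> forall j,
     frameCk f k (ldom f) (fun p => T p (lsec f j p))).

Definition hnorm {p : M} (u : E p) : R := Num.sqrt (Re (herm u u)).

End Sections.

Record gbundle (R : realType) (G : lieGroup R) (M : gRiemannian G) :=
  GBundle {
  gb_bundle :> hbundle M;
  gact : forall (g : G) (p : M), gb_bundle p -> gb_bundle (act g p);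
  gact_linear : forall g p, fib_linear (@gact g p);
  gact1 : forall p (u : gb_bundle p),
    ecast q (gb_bundle q) (act1 p) (gact lone u) = u;
  gactM : forall g h p (u : gb_bundle p),
    ecast q (gb_bundle q) (actM g h p) (gact (lmul g h) u)
    = gact g (gact h u);
  gact_unitary : forall g p (u v : gb_bundle p),
    herm (gact g u) (gact g v) = herm u v;
  gact_smooth : forall f f', frames gb_bundle f -> frames gb_bundle f' ->
    forall j, let W := [set z : G * M | ldom f z.2 /\ ldom f' (act z.1 z.2)] in
    exists a : lix f' -> G * M -> R[i],
      (forall i k, cfCk2 k W (a i)) /\
      (forall z, W z -> gact z.1 (lsec f j z.2)
                        = \sum_i a i z *: lsec f' i (act z.1 z.2))
}.

Section Translation.
Context {R : realType} {G : lieGroup R} {M : gRiemannian G} (E : gbundle M).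

(* [t] is the translate [g . s] of the section [s]. *)
Definition translate (g : G) (s t : section E) : Prop :=
  forall p, t (act g p) = gact g (s p).

Definition invariant_endo (T : endo E) : Prop :=
  forall g p (u : E p), gact g (T p u) = T (act g p) (gact g u).

End Translation.

(* A connection acts on sections of class C^1 (its value on other sections
   is meaningless).  Clifford multiplication is skew-adjoint, with square
   c(v)^2 = - |v|^2. *)
Record gClifford (R : realType) (G : lieGroup R) (M : gRiemannian G) :=
  GClifford {
  gc_bundle :> gbundle M;
  cliff : forall p : M, tangent p -> gc_bundle p -> gc_bundle p;
  cliff_linear : forall p (v : tangent p), fib_linear (cliff v);
  cliff_linear_tangent : forall p (a : R) (v w : tangent p) (u : gc_bundle p),
    cliff (a *: v + w : tangent p) u = a%:C *: cliff v u + cliff w u;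
  cliff_sqr : forall p (v : tangent p) (u : gc_bundle p),
    cliff v (cliff v u) = - (gip v v)%:C *: u;
  cliff_skew : forall p (v : tangent p) (u w : gc_bundle p),
    herm (cliff v u) w = - herm u (cliff v w);
  cliff_smooth : forall c, atlas M c -> forall f, frames gc_bundle f ->
    forall k i j, frameCk f k (cdom c `&` ldom f)
      (fun p => cliff (cframe c i p) (lsec f j p));
  cliff_equivariant : forall g p (v : tangent p) (u : gc_bundle p),
    gact g (cliff v u) = cliff (dmap (act g) v) (gact g u);
  conn : section gc_bundle -> forall p : M, tangent p -> gc_bundle p;
  conn_linear_tangent : forall s, secCk 1 s ->
    forall p (a : R) (v w : tangent p),
    conn s (a *: v + w : tangent p) = a%:C *: conn s v + conn s w;
  conn_add : forall s t, secCk 1 s -> secCk 1 t -> forall p (v : tangent p),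
    conn (fun q => s q + t q) v = conn s v + conn t v;
  conn_leibniz : forall (f : M -> R[i]) s, cfCk 1 setT f -> secCk 1 s ->
    forall p (v : tangent p),
    conn (fun q => f q *: s q) v = cdf f v *: s p + f p *: conn s v;
  conn_smooth : forall k s, secCk k.+1 s -> forall c, atlas M c ->
    forall f, frames gc_bundle f -> forall i,
    frameCk f k (cdom c) (fun p => conn s (cframe c i p));
  conn_metric : forall s t, secCk 1 s -> secCk 1 t ->
    forall p (v : tangent p),
    cdf (fun q => herm (s q) (t q)) v
    = herm (conn s v) (t p) + herm (s p) (conn t v);
  conn_clifford : forall (Y : forall q : M, tangent q) s,
    smooth_vfield Y -> secCk 1 s -> forall p (v : tangent p),
    conn (fun q => cliff (Y q) (s q)) v
    = cliff (levi_civita Y v) (s p) + cliff (Y p) (conn s v);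
  conn_invariant : forall g s t, secCk 1 s -> secCk 1 t ->
    translate g s t -> forall p (v : tangent p),
    conn t (dmap (act g) v) = gact g (conn s v)
}.

(* A Z/2-grading is given by its grading operator. *)
Record gradedGClifford (R : realType) (G : lieGroup R) (M : gRiemannian G) :=
  GradedGClifford {
  gg_clifford :> gClifford M;
  grading : endo gg_clifford;
  grading_smooth : forall k, endoCk k grading;
  grading_sqr : forall p (u : gg_clifford p), grading (grading u) = u;
  grading_self_adjoint : forall p (u v : gg_clifford p),
    herm (grading u) v = herm u (grading v);
  grading_invariant : invariant_endo grading;
  grading_cliff : forall p (v : tangent p) (u : gg_clifford p),
    grading (cliff v u) = - cliff v (grading u);
  grading_conn : forall s, secCk 1 s -> forall p (v : tangent p),
    conn (fun q => grading (s q)) v = grading (conn s v)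
}.

Section Dirac.
Context {R : realType} {G : lieGroup R} {M : gRiemannian G}.

(* The composition of the connection, the identification of T*M with TM by
   the metric, and Clifford multiplication; it is
   sum_i c(e_i) nabla_(e_i) for any orthonormal basis (e_i) of T_p M. *)
Definition dirac_op (E : gClifford M) (s : section E) : section E := fun p =>
  \sum_i \sum_j (invmx (gmet p) i j)%:C *:
    cliff (ebasis i : tangent p) (conn s (ebasis j : tangent p)).

(* The operator Phi D + D Phi, defined on sections of class C^1, is the
   order-0 operator [B]. *)
Definition anticommutator_is (E : gbundle M) (D : section E -> section E)
    (Phi B : endo E) : Prop :=
  forall s, secCk 1 s -> forall p,
    Phi p (D s p) + D (fun q => Phi q (s q)) p = B p (s p).

Definition bounded_endo (E : hbundle M) (B : endo E) : Prop :=
  exists c : R, forall p (u : E p), hnorm (B p u) <= c * hnorm u.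

Record g_admissible (E : gradedGClifford M) (D : section E -> section E)
    (Phi : endo E) : Prop := GAdmissible {
  adm_C1 : endoCk 1 Phi;
  adm_odd : forall p (u : E p), Phi p (grading u) = - grading (Phi p u);
  adm_invariant : invariant_endo Phi;
  adm_self_adjoint : forall p (u v : E p),
    herm (Phi p u) v = herm u (Phi p v);
  adm_anticommutator : exists B : endo E,
    [/\ endoCk 0 B, anticommutator_is D Phi B, bounded_endo B &
      exists (K : set M) (C : R), [/\ cocompact K, 0 < C &
        forall p, ~ K p -> forall u : E p,
          C%:C * herm u u <= herm (B p u + Phi p (Phi p u)) u]]
}.

End Dirac.

(* Matrices acting on V (x) C^N, realized as the N-tuples of elements of V. *)
Definition mxact {R : realType} {N : nat} {V : lmodType R[i]} (A : 'M[R[i]]_N)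
    (u : {ffun 'I_N -> V}) : {ffun 'I_N -> V} :=
  [ffun x => \sum_y A x y *: u y].

Section Constants.
Context {R : realType}.

Lemma Ck_cst n k (U : set 'rV[R]_n) (a : R) : Ck k U (fun=> a).
Proof.
elim: k a => [|k IH] a /=; first by move=> x _; exact: cst_continuous.
split=> [x _|v]; first exact: differentiable_cst.
have -> : (fun x => 'D_v (fun=> a) x) = fun=> (0 : R).
  by apply/funext => x; exact: derive_cst.
exact: IH.
Qed.

Lemma cfCk_cst (M : manifold R) k (U : set M) (a : R[i]) : cfCk k U (fun=> a).
Proof. by split=> c _; exact: Ck_cst. Qed.

Lemma cfCk2_cst (M N : manifold R) k (W : set (M * N)) (a : R[i]) :
  cfCk2 k W (fun=> a).
Proof. by split=> c d _ _; exact: Ck_cst. Qed.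

Lemma cdf_cst (M : manifold R) (a : R[i]) (p : M) (v : tangent p) :
  cdf (fun=> a) v = 0.
Proof. by congr (Complex _ _); exact: derive_cst. Qed.

End Constants.

Section TensorBundle.
Context {R : realType} {M : manifold R} (N : nat).

Section TensorFrame.
Context {E : M -> lmodType R[i]}.
Implicit Types (f : lframe E).

Definition tfib (p : M) : lmodType R[i] := {ffun 'I_N -> E p}.

Definition tsec f (z : 'I_N * lix f) (p : M) : tfib p :=
  [ffun y => if y == z.1 then lsec f z.2 p else 0].

Lemma tsec_sum f (p : M) (a : 'I_N * lix f -> R[i]) y :
  (\sum_z a z *: tsec z p) y = \sum_i a (y, i) *: lsec f i p.
Proof.
rewrite sum_ffunE (eq_bigr (fun z : 'I_N * lix f =>
  (a (z.1, z.2) *: tsec (z.1, z.2) p) y)) => [|[x i] _ //].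
rewrite -(pair_bigA _ (fun x i => (a (x, i) *: tsec (x, i) p) y)) /=.
rewrite (bigD1 y) //= [X in _ + X]big1 ?addr0 => [|x xy].
  by apply: eq_bigr => i _; rewrite !ffunE eqxx.
by rewrite big1 // => i _; rewrite !ffunE eq_sym (negbTE xy) scaler0.
Qed.

Lemma tsec_basis f (p : M) : ldom f p -> forall v : tfib p,
  exists! a : {ffun 'I_N * lix f -> R[i]}, v = \sum_z a z *: tsec z p.
Proof.
move=> fp v.
have /choice[a aP] : forall x, exists a : {ffun lix f -> R[i]},
    v x = \sum_i a i *: lsec f i p /\
    forall b : {ffun lix f -> R[i]}, v x = \sum_i b i *: lsec f i p -> a = b.
  by move=> x; have [a [aE aU]] := lbasis fp (v x); exists a.
exists [ffun z => a z.1 z.2]; split.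
  apply/ffunP => y; rewrite (tsec_sum p _ y) (aP y).1.
  by apply: eq_bigr => i _; rewrite ffunE.
move=> b vb; apply/ffunP => -[x i]; rewrite ffunE /=.
rewrite ((aP x).2 [ffun j => b (x, j)]) ?ffunE //.
rewrite vb (tsec_sum p _ x).
by apply: eq_bigr => j _; rewrite ffunE.
Qed.

Definition tframe f : lframe tfib :=
  LFrame (ldom_open f) (@tsec_basis f).

Lemma tframeCk f k (U : set M) (s : forall p, tfib p) :
  frameCk (tframe f) k U s <-> forall x, frameCk f k U (fun p => s p x).
Proof.
split=> [[a [aC aE]] x|H].
  exists (fun i => a (x, i)); split=> [i|p Up fp]; first exact: aC.
  by rewrite (aE p Up fp) (tsec_sum p (fun z => a z p)).
have /choice[a aP] := H.
exists (fun z => a z.1 z.2); split=> [z|p Up fp]; first exact: (aP z.1).1.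
apply/ffunP => x; rewrite (tsec_sum p (fun z => a z.1 z.2 p)).
exact: (aP x).2.
Qed.

Lemma frameCk0 f k (U : set M) : frameCk f k U (fun p => 0).
Proof.
exists (fun _ _ => 0); split=> [i|p _ _]; first exact: cfCk_cst.
by rewrite big1 // => i _; rewrite scale0r.
Qed.

Lemma frameCkZ_lsec f k (U : set M) (a : R[i]) i :
  frameCk f k U (fun p => a *: lsec f i p).
Proof.
exists (fun j _ => if j == i then a else 0); split=> [j|p _ _].
  exact: cfCk_cst.
rewrite (bigD1 i) //= eqxx big1 ?addr0 // => j /negbTE ->.
by rewrite scale0r.
Qed.

End TensorFrame.

Context (E : hbundle M).

Definition tframes (F : lframe (@tfib E)) : Prop :=
  exists2 f, frames E f & F = tframe f.

Definition therm p (u v : @tfib E p) : R[i] := \sum_x herm (u x) (v x).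

Lemma tframes_cover p : exists2 F, tframes F & ldom F p.
Proof.
by have [f Ef fp] := frames_cover E p; exists (tframe f) => //; exists f.
Qed.

Lemma tframes_compat F F' : tframes F -> tframes F' -> forall k j,
  frameCk F' k (ldom F) (lsec F j).
Proof.
move=> [f Ef ->] [f' Ef' ->] k [y j]; apply/tframeCk => x.
have [->|xy] := eqVneq x y.
  have -> : (fun p => lsec (tframe f) (y, j) p y) = lsec f j.
    by apply: functional_extensionality_dep => p; rewrite ffunE eqxx.
  exact: frames_compat.
have -> : (fun p => lsec (tframe f) (y, j) p x) = fun p => 0.
  by apply: functional_extensionality_dep => p; rewrite ffunE (negbTE xy).
exact: frameCk0.
Qed.

Lemma therm_linear p a (u v w : @tfib E p) :
  therm (a *: u + v) w = a * therm u w + therm v w.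
Proof.
rewrite /therm mulr_sumr -big_split /=; apply: eq_bigr => x _.
by rewrite !ffunE herm_linear.
Qed.

Lemma therm_conj p (u v : @tfib E p) : therm v u = (therm u v)^*.
Proof.
by rewrite /therm rmorph_sum; apply: eq_bigr => x _; rewrite herm_conj.
Qed.

Lemma herm0l p (v : E p) : herm 0 v = 0.
Proof.
by have := herm_linear (-1) 0 0 v; rewrite scaler0 addr0 mulN1r addNr.
Qed.

Lemma herm0r p (v : E p) : herm v 0 = 0.
Proof. by rewrite herm_conj herm0l rmorph0. Qed.

Lemma herm_ge0 p (v : E p) : 0 <= herm v v.
Proof.
have [->|v0] := eqVneq v 0; first by rewrite herm0l.
exact/ltW/herm_pos.
Qed.

Lemma therm_pos p (u : @tfib E p) : u != 0 -> 0 < therm u u.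
Proof.
move=> u0; have [x ux] : exists x, u x != 0.
  apply: contrapT => H; move/eqP: u0; apply; apply/ffunP => x.
  rewrite ffunE; apply/eqP; apply: contrapT => ux; apply: H; exists x.
  exact/negP.
rewrite /therm (bigD1 x) //=; apply: ltr_wpDr; last exact: herm_pos.
by apply: sumr_ge0 => y _; exact: herm_ge0.
Qed.

Lemma therm_smooth F : tframes F -> forall k i j,
  cfCk k (ldom F) (fun p => therm (lsec F i p) (lsec F j p)).
Proof.
move=> [f Ef ->] k [x i] [y j].
have tE p : therm (lsec (tframe f) (x, i) p) (lsec (tframe f) (y, j) p) =
    if x == y then herm (lsec f i p) (lsec f j p) else 0.
  rewrite /therm (bigD1 x) //= big1 => [|z zx].
    by rewrite addr0 !ffunE /= eqxx; case: eqP => // _; exact: herm0r.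
  by rewrite !ffunE /= (negbTE zx) herm0l.
rewrite (funext tE).
by case: eqP => _; [exact: herm_smooth | exact: cfCk_cst].
Qed.

Definition tensor_hbundle : hbundle M :=
  HBundle tframes_cover tframes_compat therm_linear therm_conj therm_pos
    therm_smooth.

Lemma tensor_secCk k (s : section tensor_hbundle) :
  secCk k s <-> forall x, @secCk _ _ E k (fun p => s p x).
Proof.
split=> [H x f Ef|H F [f Ef ->]].
  by move: x; apply/tframeCk; apply: H; exists f.
by apply/tframeCk => x; exact: H.
Qed.

End TensorBundle.

Section TensorGBundle.
Context {R : realType} {G : lieGroup R} {M : gRiemannian G} (N : nat)
  (E : gbundle M).
Local Notation T := (tensor_hbundle N E).

Definition tgact (g : G) (p : M) (u : T p) : T (act g p) :=
  [ffun x => gact g ((u : {ffun _}) x)].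

Lemma tgact_linear g p : fib_linear (@tgact g p).
Proof. by move=> a u v; apply/ffunP => x; rewrite !ffunE gact_linear. Qed.

Lemma tensor_cast (p q : M) (H : p = q) (u : T p) x :
  (ecast r (T r) H u : {ffun _}) x = ecast r (E r) H ((u : {ffun _}) x).
Proof. by case: q / H. Qed.

Lemma tgact1 p (u : T p) : ecast q (T q) (act1 p) (tgact lone u) = u.
Proof. by apply/ffunP => x; rewrite tensor_cast ffunE gact1. Qed.

Lemma tgactM g h p (u : T p) :
  ecast q (T q) (actM g h p) (tgact (lmul g h) u) = tgact g (tgact h u).
Proof. by apply/ffunP => x; rewrite tensor_cast !ffunE gactM. Qed.

Lemma tgact_unitary g p (u v : T p) : herm (tgact g u) (tgact g v) = herm u v.
Proof. by apply: eq_bigr => x _; rewrite !ffunE gact_unitary. Qed.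

Lemma gact0 (F : gbundle M) g p : gact g (0 : F p) = 0.
Proof.
by have := gact_linear g (-1) (0 : F p) 0; rewrite scaler0 addr0 scaleN1r addNr.
Qed.

Lemma tgact_smooth f f' : frames T f -> frames T f' -> forall j,
  let W := [set z : G * M | ldom f z.2 /\ ldom f' (act z.1 z.2)] in
  exists a : lix f' -> G * M -> R[i],
    (forall i k, cfCk2 k W (a i)) /\
    (forall z, W z -> tgact z.1 (lsec f j z.2)
                      = \sum_i a i z *: lsec f' i (act z.1 z.2)).
Proof.
move=> [e Ee ->] [e' Ee' ->] [y j] W.
have [a [aC aE]] := gact_smooth Ee Ee' j.
exists (fun z w => if z.1 == y then a z.2 w else 0); split.
  by move=> [x i] k /=; case: eqP => _; [exact: aC | exact: cfCk2_cst].
move=> z Wz; apply/ffunP => x.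
rewrite (tsec_sum _ (fun w => if w.1 == y then a w.2 z else 0)) !ffunE /=.
case: eqP => _; first exact: aE.
by rewrite gact0 big1 // => i _; rewrite scale0r.
Qed.

Definition tensor_gbundle : gbundle M :=
  GBundle tgact_linear tgact1 tgactM tgact_unitary tgact_smooth.

End TensorGBundle.

Section ComplexDerivatives.
Context {R : realType} {M : manifold R}.

Definition cderivable (f : M -> R[i]) (p : M) (v : tangent p) : Prop :=
  let c := chart_at p in
  derivable (fun x => Re (f (cinv c x))) (cmap c p) v /\
  derivable (fun x => Im (f (cinv c x))) (cmap c p) v.

Lemma eq_derivable n (h k : 'rV[R]_n -> R) x v :
  h =1 k -> derivable h x v -> derivable k x v.
Proof. by move=> /funext ->. Qed.

Lemma cderivableD (f g : M -> R[i]) p (v : tangent p) :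
  cderivable f v -> cderivable g v -> cderivable (fun q => f q + g q) v.
Proof.
move=> [fr fi] [gr gi]; split.
  apply: (eq_derivable _ (derivableD fr gr)) => x /=.
  by rewrite !fctE; case: (f _) (g _) => [? ?] [? ?].
apply: (eq_derivable _ (derivableD fi gi)) => x /=.
by rewrite !fctE; case: (f _) (g _) => [? ?] [? ?].
Qed.

Lemma cderivableM (f g : M -> R[i]) p (v : tangent p) :
  cderivable f v -> cderivable g v -> cderivable (fun q => f q * g q) v.
Proof.
move=> [fr fi] [gr gi]; split.
  apply: (eq_derivable _ (derivableB (derivableM fr gr) (derivableM fi gi))).
  by move=> x; rewrite !fctE; case: (f _) (g _) => [? ?] [? ?].
apply: (eq_derivable _ (derivableD (derivableM fr gi) (derivableM fi gr))).
by move=> x; rewrite !fctE; case: (f _) (g _) => [? ?] [? ?].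
Qed.

Lemma cderivable_conj (f : M -> R[i]) p (v : tangent p) :
  cderivable f v -> cderivable (fun q => (f q)^*) v.
Proof.
move=> [fr fi]; split.
  by apply: (eq_derivable _ fr) => x; case: (f _).
by apply: (eq_derivable _ (derivableN fi)) => x; rewrite !fctE; case: (f _).
Qed.

Lemma cfCk1_cderivable (U : set M) (f : M -> R[i]) p (v : tangent p) :
  cfCk 1 U f -> U p -> cderivable f v.
Proof.
move=> [fr fi] Up.
have pc : (cmap (chart_at p) @` (cdom (chart_at p) `&` U))
    (cmap (chart_at p) p).
  by exists p => //; split=> //; exact: chart_at_dom.
split; apply: diff_derivable.
  exact: (fr _ (chart_at_atlas p)).1.
exact: (fi _ (chart_at_atlas p)).1.
Qed.

Lemma cderivable_sum (I : Type) (r : seq I) (F : I -> M -> R[i]) p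
    (v : tangent p) :
  (forall i, cderivable (F i) v) ->
  cderivable (fun q => \sum_(i <- r) F i q) v /\
  cdf (fun q => \sum_(i <- r) F i q) v = \sum_(i <- r) cdf (F i) v.
Proof.
move=> FC; elim: r => [|i r [IH1 IH2]].
  have -> : (fun q => \sum_(i <- [::]) F i q) = fun=> 0.
    by apply/funext => q; rewrite big_nil.
  rewrite cdf_cst big_nil; split=> //.
have -> : (fun q => \sum_(j <- i :: r) F j q) =
    fun q => F i q + \sum_(j <- r) F j q.
  by apply/funext => q; rewrite big_cons.
split; first exact: cderivableD.
rewrite big_cons -IH2; have [fr fi] := FC i; have [gr gi] := IH1.
have ReD (z w : R[i]) : Re (z + w) = Re z + Re w by case: z w => [? ?] [? ?].
have ImD (z w : R[i]) : Im (z + w) = Im z + Im w by case: z w => [? ?] [? ?].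
rewrite [RHS](_ : _ = Complex
    (df (fun q => Re (F i q)) v + df (fun q => Re (\sum_(j <- r) F j q)) v)
    (df (fun q => Im (F i q)) v + df (fun q => Im (\sum_(j <- r) F j q)) v)) //.
rewrite /df -(deriveD fr gr) -(deriveD fi gi) /cdf /df.
by congr (Complex ('D_v _ _) ('D_v _ _)); apply/funext => x /=;
  rewrite (ReD, ImD).
Qed.

Lemma cdf_sum (I : finType) (F : I -> M -> R[i]) p (v : tangent p) :
  (forall i, cderivable (F i) v) ->
  cdf (fun q => \sum_i F i q) v = \sum_i cdf (F i) v.
Proof. by move=> FC; have [] := cderivable_sum (index_enum I) FC. Qed.

Lemma near_cderivable (f g : M -> R[i]) (U : set M) p (v : tangent p) :
  open U -> U p -> (forall q, U q -> f q = g q) ->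
  cderivable f v -> cderivable g v.
Proof.
move=> Uo Up fg.
have H : \forall x \near cmap (chart_at p) p, U (cinv (chart_at p) x).
  have /= := @cinv_continuous _ _ _ (chart_at p) (cmap (chart_at p) p).
  apply; first by exists p => //; exact: chart_at_dom.
  rewrite cmapK; last exact: chart_at_dom.
  by apply: open_nbhs_nbhs.
by move=> [fr fi]; split; [move: fr|move: fi]; apply: near_eq_derivable;
  apply: filterS H => x Ux; rewrite fg.
Qed.

Lemma herm_suml (E : hbundle M) (I : finType) p (F : I -> E p) (w : E p)
    (a : I -> R[i]) :
  herm (\sum_i a i *: F i) w = \sum_i a i * herm (F i) w.
Proof.
elim/big_rec2: _ => [|i x y _ <-]; first exact: herm0l.
exact: herm_linear.
Qed.

Lemma herm_cderivable (E : hbundle M) (s t : section E) :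
  secCk 1 s -> secCk 1 t -> forall p (v : tangent p),
  cderivable (fun q => herm (s q) (t q)) v.
Proof.
move=> sC tC p v; have [f Ef fp] := frames_cover E p.
have [a [aC aE]] := sC f Ef; have [b [bC bE]] := tC f Ef.
apply: (@near_cderivable (fun q => \sum_i a i q *
    (\sum_j b j q * herm (lsec f j q) (lsec f i q))^*) _ (ldom f)) => //.
- exact: ldom_open.
- move=> q fq; rewrite (aE q) // herm_suml; apply: eq_bigr => i _.
  by rewrite -herm_suml -bE // -herm_conj.
apply: (cderivable_sum _ _).1 => i; apply: cderivableM.
  by apply: cfCk1_cderivable (aC i) _.
apply/cderivable_conj/(cderivable_sum _ _).1 => j; apply: cderivableM.
  by apply: cfCk1_cderivable (bC j) _.
by apply: cfCk1_cderivable (herm_smooth Ef 1 j i) _.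
Qed.

End ComplexDerivatives.

Section DoubledBundle.
Context {R : realType} {G : lieGroup R} {M : gRiemannian G}
  (E : gClifford M) (l : nat).

(* C^(l+l) = C^l (+) (C^l)^op, the first summand being even. *)
Local Notation T := (tensor_gbundle (l + l) E).

Definition swap_mx : 'M[R[i]]_(l + l) := block_mx 0 1%:M 1%:M 0.
Definition grading_mx : 'M[R[i]]_(l + l) := block_mx 1%:M 0 0 (- 1%:M).

Definition op_tensor1 (D : section E -> section E) (s : section T) :
    section T :=
  fun p => [ffun x => D (fun q => (s q : {ffun 'I_(l + l) -> E q}) x) p].

(* The matrix [[0, D (x) 1], [D (x) 1, 0]]. *)
Definition off_diagonal_op (D : section E -> section E) (s : section T) :
    section T :=
  fun p => mxact swap_mx (op_tensor1 D s p).

Definition dcliff (p : M) (v : tangent p) (u : T p) : T p :=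
  mxact swap_mx [ffun x => cliff v ((u : {ffun 'I_(l + l) -> E p}) x)].

Definition dconn (s : section T) (p : M) (v : tangent p) : T p :=
  [ffun x => conn (fun q => (s q : {ffun 'I_(l + l) -> E q}) x) v].

Definition dgrading : endo T := fun p u => mxact grading_mx u.

Definition swap_ord (x : 'I_(l + l)) : 'I_(l + l) :=
  match fintype.split x with inl a => rshift l a | inr a => lshift l a end.

Lemma swap_ordK : involutive swap_ord.
Proof.
move=> x; rewrite -[RHS]splitK /swap_ord.
by case: (fintype.split x) => a /=; rewrite ?(unsplitK (inr a)) ?(unsplitK (inl a)).
Qed.

Lemma swap_mxactE (V : lmodType R[i]) (u : {ffun 'I_(l + l) -> V}) x :
  mxact swap_mx u x = u (swap_ord x).
Proof.
rewrite ffunE big_split_ord /= -[x in LHS]splitK /swap_ord.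
case: (fintype.split x) => a /=.
  rewrite big1 ?add0r => [|b _]; last by rewrite block_mxEul mxE scale0r.
  rewrite (bigD1 a) //= block_mxEur mxE eqxx scale1r big1 ?addr0 // => b ba.
  by rewrite block_mxEur mxE eq_sym (negbTE ba) scale0r.
rewrite [X in _ + X]big1 ?addr0 => [|b _]; last first.
  by rewrite block_mxEdr mxE scale0r.
rewrite (bigD1 a) //= block_mxEdl mxE eqxx scale1r big1 ?addr0 // => b ba.
by rewrite block_mxEdl mxE eq_sym (negbTE ba) scale0r.
Qed.

Definition sgn_ord (x : 'I_(l + l)) : R[i] := if fintype.split x then 1 else -1.

Lemma grading_mxactE (V : lmodType R[i]) (u : {ffun 'I_(l + l) -> V}) x :
  mxact grading_mx u x = sgn_ord x *: u x.
Proof.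
rewrite ffunE big_split_ord /= -[x in LHS]splitK -[x in u x]splitK /sgn_ord.
case: (fintype.split x) => a /=.
  rewrite [X in _ + X]big1 ?addr0 => [|b _]; last first.
    by rewrite block_mxEur mxE scale0r.
  rewrite (bigD1 a) //= block_mxEul mxE eqxx big1 ?addr0 // => b ba.
  by rewrite block_mxEul mxE eq_sym (negbTE ba) scale0r.
rewrite big1 ?add0r => [|b _]; last by rewrite block_mxEdl mxE scale0r.
rewrite (bigD1 a) //= block_mxEdr !mxE eqxx big1 ?addr0 // => b ba.
by rewrite block_mxEdr !mxE eq_sym (negbTE ba) oppr0 scale0r.
Qed.

Lemma sgn_swap x : sgn_ord (swap_ord x) = - sgn_ord x.
Proof.
rewrite /sgn_ord /swap_ord; case: (fintype.split x) => a.
  by rewrite (unsplitK (inr a)).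
by rewrite (unsplitK (inl a)) opprK.
Qed.

Lemma sgn_sqr x : sgn_ord x * sgn_ord x = 1.
Proof. by rewrite /sgn_ord; case: (fintype.split x) => ?; rewrite ?mulrNN mulr1. Qed.

Lemma sgn_conj x : (sgn_ord x)^* = sgn_ord x.
Proof.
by rewrite /sgn_ord; case: (fintype.split x) => ?; rewrite ?rmorphN rmorph1.
Qed.

Lemma dcliffE p (v : tangent p) (u : T p) x :
  (dcliff v u : {ffun 'I_(l + l) -> E p}) x = cliff v ((u : {ffun 'I_(l + l) -> E p}) (swap_ord x)).
Proof. by rewrite /dcliff swap_mxactE ffunE. Qed.

Lemma dgradingE p (u : T p) x :
  (dgrading u : {ffun 'I_(l + l) -> E p}) x = sgn_ord x *: (u : {ffun 'I_(l + l) -> E p}) x.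
Proof. exact: grading_mxactE. Qed.

Lemma hermZl (F : hbundle M) p a (u v : F p) : herm (a *: u) v = a * herm u v.
Proof. by have := herm_linear a u 0 v; rewrite herm0l !addr0. Qed.

Lemma hermZr (F : hbundle M) p a (u v : F p) :
  herm u (a *: v) = a^* * herm u v.
Proof. by rewrite herm_conj hermZl rmorphM /= -herm_conj. Qed.

Lemma fib_linearZ (V W : lmodType R[i]) (f : V -> W) : fib_linear f ->
  forall a u, f (a *: u) = a *: f u.
Proof.
move=> fL a u; have f0 : f 0 = 0.
  by have := fL (-1) 0 0; rewrite scaler0 addr0 scaleN1r addNr.
by have := fL a u 0; rewrite f0 !addr0.
Qed.

Lemma cliffZ (F : gClifford M) p (v : tangent p) a (u : F p) :
  cliff v (a *: u) = a *: cliff v u.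
Proof. exact: (fib_linearZ (@cliff_linear _ _ _ F p v)). Qed.

Lemma dcliff_linear p (v : tangent p) : fib_linear (@dcliff p v).
Proof.
by move=> a u w; apply/ffunP => x; rewrite !(dcliffE, ffunE) cliff_linear.
Qed.

Lemma dcliff_linear_tangent p (a : R) (v w : tangent p) (u : T p) :
  dcliff (a *: v + w : tangent p) u = a%:C *: dcliff v u + dcliff w u.
Proof.
by apply/ffunP => x; rewrite !(dcliffE, ffunE) cliff_linear_tangent.
Qed.

Lemma dcliff_sqr p (v : tangent p) (u : T p) :
  dcliff v (dcliff v u) = - (gip v v)%:C *: u.
Proof.
by apply/ffunP => x; rewrite !(dcliffE, ffunE) swap_ordK cliff_sqr.
Qed.

Lemma dcliff_skew p (v : tangent p) (u w : T p) :
  herm (dcliff v u) w = - herm u (dcliff v w).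
Proof.
rewrite /herm /= /therm (reindex_inj (inv_inj swap_ordK)) /= -sumrN.
by apply: eq_bigr => x _; rewrite !dcliffE swap_ordK cliff_skew.
Qed.

Lemma dcliff_smooth c : atlas M c -> forall f, frames T f ->
  forall k i j, frameCk f k (cdom c `&` ldom f)
    (fun p => dcliff (cframe c i p) (lsec f j p)).
Proof.
move=> Mc F [f Ef ->] k i [y j]; apply/tframeCk => x.
have [xy|xy] := eqVneq (swap_ord x) y.
  have -> : (fun p => dcliff (cframe c i p) (tsec (y, j) p) x) =
      fun p => cliff (cframe c i p) (lsec f j p).
    apply: functional_extensionality_dep => p.
    by rewrite dcliffE ffunE /= xy eqxx.
  exact: cliff_smooth.
have -> : (fun p => dcliff (cframe c i p) (tsec (y, j) p) x) = fun p => 0.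
  apply: functional_extensionality_dep => p.
  rewrite dcliffE ffunE /= (negbTE xy) -[X in cliff _ X](scale0r 0).
  by rewrite cliffZ scale0r.
exact: frameCk0.
Qed.

Lemma dcliff_equivariant g p (v : tangent p) (u : T p) :
  gact g (dcliff v u) = dcliff (dmap (act g) v) (gact g u).
Proof.
by apply/ffunP => x; rewrite !(dcliffE, ffunE) cliff_equivariant.
Qed.

Lemma dsecCk k (s : section T) : secCk k s ->
  forall x, @secCk _ _ E k (fun q => (s q : {ffun 'I_(l + l) -> E q}) x).
Proof. by move=> /tensor_secCk. Qed.

Lemma dconn_linear_tangent s : secCk 1 s ->
  forall p (a : R) (v w : tangent p),
  dconn s (a *: v + w : tangent p) = a%:C *: dconn s v + dconn s w.
Proof.
move=> sC p a v w; apply/ffunP => x; rewrite !ffunE.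
by rewrite conn_linear_tangent //; exact: dsecCk.
Qed.

Lemma dconn_add s t : secCk 1 s -> secCk 1 t -> forall p (v : tangent p),
  dconn (fun q => s q + t q) v = dconn s v + dconn t v.
Proof.
move=> sC tC p v; apply/ffunP => x; rewrite !ffunE.
rewrite -conn_add; [|exact: dsecCk|exact: dsecCk].
congr (conn _ v); apply: functional_extensionality_dep => q; by rewrite ffunE.
Qed.

Lemma dconn_leibniz (f : M -> R[i]) s : cfCk 1 setT f -> secCk 1 s ->
  forall p (v : tangent p),
  dconn (fun q => f q *: s q) v = cdf f v *: s p + f p *: dconn s v.
Proof.
move=> fC sC p v; apply/ffunP => x; rewrite !ffunE.
rewrite -conn_leibniz //; last exact: dsecCk.
congr (conn _ v); apply: functional_extensionality_dep => q; by rewrite ffunE.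
Qed.

Lemma dconn_smooth k s : secCk k.+1 s -> forall c, atlas M c ->
  forall f, frames T f -> forall i,
  frameCk f k (cdom c) (fun p => dconn s (cframe c i p)).
Proof.
move=> sC c Mc F [f Ef ->] i; apply/tframeCk => x.
have -> : (fun p => dconn s (cframe c i p) x) =
    fun p => conn (fun q => (s q : {ffun 'I_(l + l) -> E q}) x) (cframe c i p).
  by apply: functional_extensionality_dep => p; rewrite ffunE.
by apply: conn_smooth => //; exact: dsecCk.
Qed.

Lemma dconn_metric s t : secCk 1 s -> secCk 1 t ->
  forall p (v : tangent p),
  cdf (fun q => herm (s q) (t q)) v
  = herm (dconn s v) (t p) + herm (s p) (dconn t v).
Proof.
move=> sC tC p v.
rewrite -[LHS]/(cdf (fun q => \sum_x herm ((s q : {ffun 'I_(l + l) -> E q}) x)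
  ((t q : {ffun 'I_(l + l) -> E q}) x)) v) cdf_sum; last first.
  by move=> x; apply: herm_cderivable; exact: dsecCk.
rewrite -[RHS]/(\sum_x _ + \sum_x _) -big_split /=; apply: eq_bigr => x _.
by rewrite !ffunE conn_metric //; exact: dsecCk.
Qed.

Lemma dconn_clifford (Y : forall q : M, tangent q) s :
  smooth_vfield Y -> secCk 1 s -> forall p (v : tangent p),
  dconn (fun q => dcliff (Y q) (s q)) v
  = dcliff (levi_civita Y v) (s p) + dcliff (Y p) (dconn s v).
Proof.
move=> YC sC p v; apply/ffunP => x; rewrite [LHS]ffunE [RHS]ffunE !dcliffE.
rewrite [X in cliff (Y p) X]ffunE.
rewrite -(conn_clifford YC); last exact: dsecCk.
by congr (conn _ v); apply: functional_extensionality_dep => q;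
  rewrite dcliffE.
Qed.

Lemma dconn_invariant g s t : secCk 1 s -> secCk 1 t ->
  translate g s t -> forall p (v : tangent p),
  dconn t (dmap (act g) v) = gact g (dconn s v).
Proof.
move=> sC tC st p v; apply/ffunP => x; rewrite !ffunE.
apply: conn_invariant; [exact: dsecCk | exact: dsecCk |].
by move=> q; rewrite st ffunE.
Qed.

Definition doubled_gClifford : gClifford M :=
  GClifford dcliff_linear dcliff_linear_tangent dcliff_sqr dcliff_skew
    dcliff_smooth dcliff_equivariant dconn_linear_tangent dconn_add
    dconn_leibniz dconn_smooth dconn_metric dconn_clifford dconn_invariant.

Lemma dgrading_smooth k : endoCk k dgrading.
Proof.
split=> [p a u w|F [f Ef ->] [y j]].
  apply/ffunP => x; rewrite !(dgradingE, ffunE) scalerDr !scalerA.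
  by rewrite mulrC.
apply/tframeCk => x; have [->|xy] := eqVneq x y.
  have -> : (fun p => dgrading (tsec (y, j) p) y) =
      fun p => sgn_ord y *: lsec f j p.
    by apply: functional_extensionality_dep => p; rewrite dgradingE ffunE eqxx.
  exact: frameCkZ_lsec.
have -> : (fun p => dgrading (tsec (y, j) p) x) = fun p => 0.
  apply: functional_extensionality_dep => p.
  by rewrite dgradingE ffunE (negbTE xy) scaler0.
exact: frameCk0.
Qed.

Lemma dgrading_sqr p (u : T p) : dgrading (dgrading u) = u.
Proof.
by apply/ffunP => x; rewrite !dgradingE scalerA sgn_sqr scale1r.
Qed.

Lemma dgrading_self_adjoint p (u w : T p) :
  herm (dgrading u) w = herm u (dgrading w).
Proof.
by apply: eq_bigr => x _; rewrite !dgradingE hermZl hermZr sgn_conj.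
Qed.

Lemma dgrading_invariant : invariant_endo dgrading.
Proof.
move=> g p u; apply/ffunP => x; rewrite !(dgradingE, ffunE).
exact: (fib_linearZ (@gact_linear _ _ _ E g p)).
Qed.

Lemma dgrading_cliff p (v : tangent p) (u : T p) :
  dgrading (dcliff v u) = - dcliff v (dgrading u).
Proof.
apply/ffunP => x; rewrite !(dgradingE, dcliffE, ffunE) cliffZ sgn_swap.
by rewrite scaleNr opprK.
Qed.

Lemma dgrading_conn s : secCk 1 s -> forall p (v : tangent p),
  dconn (fun q => dgrading (s q)) v = dgrading (dconn s v).
Proof.
move=> sC p v; apply/ffunP => x; rewrite !(dgradingE, ffunE).
have -> : (fun q => (dgrading (s q) : {ffun 'I_(l + l) -> E q}) x) =
    fun q => sgn_ord x *: (s q : {ffun 'I_(l + l) -> E q}) x.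
  by apply: functional_extensionality_dep => q; rewrite dgradingE.
rewrite (@conn_leibniz _ _ _ E (fun=> sgn_ord x)); last exact: dsecCk.
  by rewrite cdf_cst scale0r add0r.
exact: cfCk_cst.
Qed.

Definition doubled_bundle : gradedGClifford M :=
  @GradedGClifford _ _ _ doubled_gClifford dgrading dgrading_smooth
    dgrading_sqr dgrading_self_adjoint dgrading_invariant dgrading_cliff
    dgrading_conn.

(* The Dirac operator of the doubled bundle is the expected matrix. *)
Lemma dirac_op_doubled (s : section doubled_bundle) :
  dirac_op s = off_diagonal_op (@dirac_op _ _ _ E) s.
Proof.
apply: functional_extensionality_dep => p; apply/ffunP => x.
rewrite swap_mxactE ffunE /dirac_op sum_ffunE; apply: eq_bigr => i _.
rewrite sum_ffunE; apply: eq_bigr => j _.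
by rewrite ffunE dcliffE ffunE.
Qed.

End DoubledBundle.

Section CalliasPotential.
Context {R : realType} {G : lieGroup R} {M : gRiemannian G}.

Definition fun_adjmx {l : nat} (P : 'M[M -> R[i]]_l) : 'M[M -> R[i]]_l :=
  map_mx (fun f p => (f p)^*) P^T.

Definition mx_at {l : nat} (P : 'M[M -> R[i]]_l) (p : M) : 'M[R[i]]_l :=
  map_mx (fun f => f p) P.

Definition callias_endo (E : gClifford M) {l : nat} (P : 'M[M -> R[i]]_l) :
    endo (doubled_bundle E l) := fun p u =>
  'i%C *: mxact (block_mx 0 (1%:M - 2 *: mx_at P p)
                          (2 *: mx_at P p - 1%:M) 0) u.

Arguments callias_endo E {l} P.

Definition corona_projection {l : nat} (P0 : 'M[corona_ring M]_l) : Prop :=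
  [/\ forall i j, CcoronaG M (P0 i j),
      P0 *m P0 = P0 &
      map_mx (@corona_star _ _ M) P0^T = P0].

End CalliasPotential.
Arguments callias_endo {R G M} E {l} P.

(* Main.v *)
(** The potential is multiplication by a Hermitian matrix [S] of functions which
    is odd and anticommutes with the swap of the two summands, and
    [D = swap o (D_{E_0} (x) 1)].  By the Leibniz rule, [Phi D + D Phi] is
    therefore the order-0 operator built from Clifford multiplication by the
    gradients of the entries of [S].  Its norm is controlled by the norms of the
    differentials of the entries of [P], which tend to zero at infinity in
    [M/G], while [Phi^2 = (2P-1)^2 = 1 + 4 (P^2 - P)] tends to the identity.
    So [Phi D + D Phi + Phi^2 - 1] has small norm off a cocompact set. *)
Require Import Defs.
From mathcomp Require Import all_boot all_order all_algebra.
From mathcomp Require Import all_classical all_reals all_analysis.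
From mathcomp Require Import complex.
From mathcomp Require Import ring lra.

Set Implicit Arguments.
Unset Strict Implicit.
Unset Printing Implicit Defensive.

Import Order.TTheory GRing.Theory Num.Theory.
Import numFieldNormedType.Exports.

Local Open Scope classical_set_scope.
Local Open Scope complex_scope.
Local Open Scope ring_scope.

(* [Num.Theory] and the probability library shadow these names. *)
Local Notation Re := complex.Re.
Local Notation Im := complex.Im.
Local Notation cdf := Defs.cdf.

(** Two features of the setting shape the proof. Tangent vectors at a point are read in a preferred
    chart that may jump from point to point, so the components of [df] and of the metric have no
    continuity as they stand. Continuity of the order-0 operator is obtained by writing the gradient
    in the coordinate frame of one fixed chart around a point, then gluing. The inequality of
    condition (c) is stated in the order of [R[i]], where comparable numbers have equal imaginary
    parts. Smallness of [Phi D + D Phi] is therefore not enough: its self-adjointness enters as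
    well. Estimates use squared norms with crude constants depending only on [l], since decay at
    infinity absorbs any such factor. Global boundedness is a separate matter from decay and comes
    from compactness in the orbit space. *)

Lemma near_eq_continuous_at (T U : topologicalType) (f g : T -> U) (t : T) :
  (\forall s \near t, f s = g s) ->
  {for t, continuous f} -> {for t, continuous g}.
Proof.
move=> fg fC; suff: g @ t --> g t by [].
rewrite -(nbhs_singleton fg); apply: cvg_trans fC.
by apply: (near_eq_cvg (F := nbhs t)); apply: filterS fg => s ->.
Qed.

(** Differentiability is a little-o expansion, which sees only the germ: the expansion of [f] serves
    for [g] with the same linear part, and uniqueness of the differential identifies that part with
    ['d g x]. *)
Lemma near_eq_differentiable (K : numFieldType) (V W : normedModType K)
    (f g : V -> W) (x : V) :
  (\forall y \near x, f y = g y) -> differentiable f x -> differentiable g x.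
Proof.
move=> fg /diff_locallyP[dfC fE].
have gE : g \o shift x = cst (g x) + 'd f x +o_ (0 : V) id.
  apply/eqaddoP => e e0; move/eqaddoP : fE => /(_ e e0).
  have : \forall h \near (0 : V), f (h + x) = g (h + x).
    move: fg; rewrite (near_shift 0) /=.
    by apply: filterS => h /=; rewrite subr0.
  apply: filterS2 => h; rewrite !fctE /= => <-.
  by rewrite (nbhs_singleton fg).
by apply/diff_locallyP; rewrite (diff_unique dfC gE).
Qed.

(** * Functions of class C^k on open subsets of R^n *)

Section Ck.
Context {R : realType} {n : nat}.
Implicit Types (U V : set 'rV[R]_n) (f g : 'rV[R]_n -> R).

Lemma Ck_sub k U V f : V `<=` U -> Ck k U f -> Ck k V f.
Proof.
elim: k f => [|k IH] f VU /=; first by move=> fC x /VU /fC.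
move=> [fD fC]; split=> [x /VU /fD //|v]; exact: IH.
Qed.

Lemma CkS k U f : Ck k.+1 U f -> Ck k U f.
Proof.
elim: k f => [|k IH] f [fD fC]; first by move=> x /fD
  /differentiable_continuous.
by split=> // v; apply: IH; exact: fC.
Qed.

(** Openness of [U] turns equality on [U] into equality of germs, so the directional derivatives
    agree on [U] too and the induction goes on. *)
Lemma Ck_ext k U f g : open U -> (forall x, U x -> f x = g x) ->
  Ck k U f -> Ck k U g.
Proof.
move=> Uo; have near_fg (h h' : 'rV[R]_n -> R) :
    (forall x, U x -> h x = h' x) ->
    forall x, U x -> \forall y \near x, h y = h' y.
  move=> hh' x Ux; have : \forall y \near x, U y by exact: open_nbhs_nbhs.
  by apply: filterS => y; exact: hh'.
elim: k f g => [|k IH] f g fg.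
  move=> fC x Ux; apply: near_eq_continuous_at (fC x Ux).
  exact: near_fg.
move=> [fD fC]; split=> [x Ux|v].
  exact: near_eq_differentiable (near_fg _ _ fg x Ux) (fD x Ux).
apply: IH (fC v) => x Ux; apply: near_eq_derive.
exact: near_fg.
Qed.

Lemma CkD k U f g : open U -> Ck k U f -> Ck k U g ->
  Ck k U (fun x => f x + g x).
Proof.
move=> Uo; elim: k f g => [|k IH] f g.
  by move=> fC gC x Ux; exact: (continuousD (fC x Ux) (gC x Ux)).
move=> [fD fC] [gD gC]; split=> [x Ux|v].
  by apply: differentiableD; [exact: fD | exact: gD].
apply: Ck_ext (IH _ _ (fC v) (gC v)) => // x Ux.
by rewrite -deriveD //; apply: diff_derivable; [exact: fD | exact: gD].
Qed.

(** The Leibniz formula multiplies a derivative of one factor by the other factor itself, whose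
    order [CkS] must first lower to [k]. *)
Lemma CkM k U f g : open U -> Ck k U f -> Ck k U g ->
  Ck k U (fun x => f x * g x).
Proof.
move=> Uo; elim: k f g => [|k IH] f g.
  by move=> fC gC x Ux; exact: (continuousM (fC x Ux) (gC x Ux)).
move=> fC gC; have [[fD fv] [gD gv]] := (fC, gC); split=> [x Ux|v].
  by apply: differentiableM; [exact: fD | exact: gD].
have := CkD Uo (IH _ _ (CkS fC) (gv v)) (IH _ _ (CkS gC) (fv v)).
apply: Ck_ext => // x Ux.
by rewrite [RHS]deriveM //; apply: diff_derivable; [exact: fD | exact: gD].
Qed.

End Ck.

(** * Functions of class C^k on a manifold, read in charts *)

Section ChartCalculus.
Context {R : realType} {M : manifold R}.
Implicit Types (U V : set M) (f g : M -> R) (c d : chart R (mdim M) M).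

Lemma near_chart c U p : open U -> cdom c p -> U p ->
  \forall x \near cmap c p, (cmap c @` (cdom c `&` U)) x.
Proof.
move=> Uo cp Up.
have cpR : (cmap c @` cdom c) (cmap c p) by exists p.
have H1 : \forall x \near cmap c p, (cmap c @` cdom c) x.
  by apply: open_nbhs_nbhs; split=> //; exact: cran_open.
have H2 : \forall x \near cmap c p, U (cinv c x).
  have /= := @cinv_continuous _ _ _ c _ cpR; apply; rewrite cmapK //.
  exact: open_nbhs_nbhs.
apply: filterS2 H1 H2 => x [q cq <-]; rewrite cmapK // => Uq.
by exists q.
Qed.

Lemma chart_image_open c U : open U -> open (cmap c @` (cdom c `&` U)).
Proof.
move=> Uo; rewrite openE => x [p [cp Up] <-].
exact: near_chart.
Qed.

Lemma fCk_sub k U V f : V `<=` U -> fCk k U f -> fCk k V f.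
Proof.
move=> VU fC c Mc; apply: Ck_sub (fC c Mc).
by move=> x [p [cp Vp] <-]; exists p => //; split=> //; exact: VU.
Qed.

Lemma fCkD k U f g : open U -> fCk k U f -> fCk k U g ->
  fCk k U (fun p => f p + g p).
Proof.
move=> Uo fC gC c Mc; apply: CkD; first exact: chart_image_open.
- exact: fC.
- exact: gC.
Qed.

Lemma fCkM k U f g : open U -> fCk k U f -> fCk k U g ->
  fCk k U (fun p => f p * g p).
Proof.
move=> Uo fC gC c Mc; apply: CkM; first exact: chart_image_open.
- exact: fC.
- exact: gC.
Qed.

Lemma fCk_cst k U (a : R) : fCk k U (fun=> a).
Proof. by move=> c _; exact: Ck_cst. Qed.

(** Charts are homeomorphisms, so a condition over all charts becomes pointwise continuity on [M].
    For the direct implication a single chart at each point suffices; this is the form needed for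
    gluing. *)
Lemma fCk0P U f : open U ->
  fCk 0 U f <-> forall p, U p -> {for p, continuous f}.
Proof.
move=> Uo; split=> [fC p Up|fC c Mc x [p [cp Up] <-]]; last first.
  have fp : f @ cinv c (cmap c p) --> f (cinv c (cmap c p)).
    by rewrite cmapK //; exact: fC.
  apply: continuous_comp fp.
  by apply: cinv_continuous; exists p.
have cp := chart_at_dom p.
have /= fcp : {for cmap (chart_at p) p, continuous (f \o cinv (chart_at p))}.
  by apply: (fC _ (chart_at_atlas p)); exists p.
pose h := f \o cinv (chart_at p) \o cmap (chart_at p).
have hp : {for p, continuous h}.
  by apply: continuous_comp fcp; exact: cmap_continuous.
apply: near_eq_continuous_at hp.
have : \forall q \near p, cdom (chart_at p) q.
  by apply: open_nbhs_nbhs; split=> //; exact: cdom_open.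
by apply: filterS => q cq; rewrite /h /= cmapK.
Qed.

End ChartCalculus.

(** * Complex-valued functions and their differentials *)

Section ComplexParts.
Context {R : realType}.
Implicit Types z w : R[i].

Lemma cReD z w : Re (z + w) = Re z + Re w.
Proof. by case: z w => [? ?] [? ?]. Qed.

Lemma cImD z w : Im (z + w) = Im z + Im w.
Proof. by case: z w => [? ?] [? ?]. Qed.

Lemma cReM z w : Re (z * w) = Re z * Re w - Im z * Im w.
Proof. by case: z w => [? ?] [? ?]. Qed.

Lemma cImM z w : Im (z * w) = Re z * Im w + Im z * Re w.
Proof. by case: z w => [? ?] [? ?]. Qed.

End ComplexParts.

Section ComplexFunctions.
Context {R : realType} {M : manifold R}.
Implicit Types (U V : set M) (f g : M -> R[i]).

Lemma cfCk_sub k U V f : V `<=` U -> cfCk k U f -> cfCk k V f.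
Proof. by move=> VU [fr fi]; split; [exact: fCk_sub fr|exact: fCk_sub fi]. Qed.

Lemma cfCkD k U f g : open U -> cfCk k U f -> cfCk k U g ->
  cfCk k U (fun p => f p + g p).
Proof.
move=> Uo [fr fi] [gr gi]; split.
  by under eq_fun do rewrite cReD; exact: fCkD.
by under eq_fun do rewrite cImD; exact: fCkD.
Qed.

Lemma cfCkM k U f g : open U -> cfCk k U f -> cfCk k U g ->
  cfCk k U (fun p => f p * g p).
Proof.
move=> Uo [fr fi] [gr gi]; split.
  under eq_fun do rewrite cReM -mulN1r.
  apply: fCkD => //; first exact: fCkM.
  by apply: fCkM => //; [exact: fCk_cst | exact: fCkM].
by under eq_fun do rewrite cImM; apply: fCkD => //; exact: fCkM.
Qed.

(** Each entry of the potential is such an affine expression in an entry of [P]. Multiplication by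
    [a] mixes real and imaginary parts, so both are expanded. *)
Lemma cdf_affine (k a : R[i]) f p (v : tangent p) : cderivable f v ->
  cdf (fun q => k + a * f q) v = a * cdf f v.
Proof.
move=> [fr fi]; rewrite /cdf /df; set x := cmap _ _.
set fR := (X in derivable X x v) in fr; set fI := (X in derivable X x v) in fi.
rewrite (_ : _ \o _ =
    (fun=> Re k) + (Re a *: fR - Im a *: fI)); last first.
  by apply/funext => y /=; rewrite !fctE cReD cReM.
rewrite (_ : (fun q => Im (k + _)) \o _ =
    (fun=> Im k) + (Re a *: fI + Im a *: fR)); last first.
  by apply/funext => y /=; rewrite !fctE cImD cImM.
have [] := (derivableZ (k := Re a) fr, derivableZ (k := Im a) fr).
have [] := (derivableZ (k := Re a) fi, derivableZ (k := Im a) fi).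
move=> ai bi ar br.
rewrite (deriveD (derivable_cst _ _ _) (derivableB ar bi)) (deriveB ar bi).
rewrite (deriveD (derivable_cst _ _ _) (derivableD ai br)) (deriveD ai br).
rewrite !derive_cst !add0r (deriveZ _ fr) (deriveZ _ fi).
rewrite (deriveZ _ fr) (deriveZ _ fi).
by case: (a).
Qed.

End ComplexFunctions.

(** * Regularity of sections in local frames *)

Section FrameCk.
Context {R : realType} {M : manifold R} {E : M -> lmodType R[i]}.
Implicit Types (f : lframe E) (U V : set M) (s t : forall p, E p).

Lemma frameCkD f k U s t : open U -> frameCk f k U s -> frameCk f k U t ->
  frameCk f k U (fun p => s p + t p).
Proof.
move=> Uo [a [aC aE]] [b [bC bE]]; exists (fun i p => a i p + b i p); split.
  by move=> i; apply: cfCkD => //; apply: openI => //; exact: ldom_open.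
move=> p Up fp; rewrite aE // bE // -big_split /=.
by apply: eq_bigr => i _; rewrite scalerDl.
Qed.

Lemma frameCkM f k U (h : M -> R[i]) s : open U -> cfCk k U h ->
  frameCk f k U s -> frameCk f k U (fun p => h p *: s p).
Proof.
move=> Uo hC [a [aC aE]]; exists (fun i p => h p * a i p); split.
  move=> i; apply: cfCkM => //; first by apply: openI => //; exact: ldom_open.
  by apply: cfCk_sub hC => p [].
move=> p Up fp; rewrite aE // scaler_sumr.
by apply: eq_bigr => i _; rewrite scalerA.
Qed.

Lemma frameCk_sum (I : Type) (r : seq I) f k U (s : I -> forall p, E p) :
  open U -> (forall i, frameCk f k U (s i)) ->
  frameCk f k U (fun p => \sum_(i <- r) s i p).
Proof.
move=> Uo sC; elim: r => [|i r IH].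
  rewrite (_ : (fun p => _) = fun p => 0); first exact: frameCk0.
  by apply: functional_extensionality_dep => p; rewrite big_nil.
rewrite (_ : (fun p => _) = fun p => s i p + \sum_(j <- r) s j p).
  exact: frameCkD.
by apply: functional_extensionality_dep => p; rewrite big_cons.
Qed.

(* The coefficients in a frame are unique, so local ones glue. *)
Lemma frameC0_local f U s : open U ->
  (forall p, U p -> ldom f p -> exists V, [/\ open V, V p & frameCk f 0 V s]) ->
  frameCk f 0 U s.
Proof.
move=> Uo sloc.
have /choice[a aP] : forall p, exists a : {ffun lix f -> R[i]},
    ldom f p -> s p = \sum_i a i *: lsec f i p /\
    forall b : {ffun lix f -> R[i]}, s p = \sum_i b i *: lsec f i p -> a = b.
  (* Off the domain of the frame the coefficients take the default value 0, about which nothing is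
     claimed. *)
  move=> p; have [fp|] := pselect (ldom f p); last by exists [ffun=> 0].
  by have [a [aE aU]] := lbasis fp (s p); exists a.
exists (fun i p => a p i); split=> [i|p Up fp]; last exact: (aP p fp).1.
have near_eq p : (U `&` ldom f) p -> exists b : M -> R[i],
    [/\ {for p, continuous (fun q => Re (b q))},
        {for p, continuous (fun q => Im (b q))} &
        \forall q \near p, b q = a q i].
  move=> [Up fp]; have [V [Vo Vp [b [bC bE]]]] := sloc p Up fp.
  have Wo : open (V `&` ldom f) by apply: openI => //; exact: ldom_open.
  have [bR bI] := bC i; exists (b i); split.
  - by move/(fCk0P _ Wo) : bR; apply.
  - by move/(fCk0P _ Wo) : bI; apply.
  have : \forall q \near p, (V `&` ldom f) q by exact: open_nbhs_nbhs.
  apply: filterS => q [Vq fq].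
  rewrite ((aP q fq).2 [ffun i => b i q]) ?ffunE // (bE q Vq fq).
  by apply: eq_bigr => j _; rewrite ffunE.
have Wo : open (U `&` ldom f) by apply: openI => //; exact: ldom_open.
split; apply/fCk0P => // p /near_eq[b [bR bI ba]].
  by apply: near_eq_continuous_at bR; apply: filterS ba => q ->.
by apply: near_eq_continuous_at bI; apply: filterS ba => q ->.
Qed.

End FrameCk.

Section SectionCk.
Context {R : realType} {M : manifold R} {E : hbundle M}.
Implicit Types s t : section E.

Lemma secCkM k (h : M -> R[i]) s : cfCk k setT h -> secCk k s ->
  secCk k (fun p => h p *: s p).
Proof.
by move=> hC sC f Ef; apply: frameCkM => //; [exact: openT | exact: sC].
Qed.

Lemma secCk_sum (I : Type) (r : seq I) k (s : I -> section E) :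
  (forall i, secCk k (s i)) -> secCk k (fun p => \sum_(i <- r) s i p).
Proof.
by move=> sC f Ef; apply: frameCk_sum => [|i]; [exact: openT | exact: sC].
Qed.

End SectionCk.

Lemma derive_comp (K : numFieldType) (U V W : normedModType K)
    (f : U -> V) (g : V -> W) (x v : U) :
  differentiable f x -> differentiable g (f x) ->
  'D_v (g \o f) x = 'D_('D_v f x) g (f x).
Proof.
move=> fD gD; rewrite !deriveE //; last exact: differentiable_comp.
by rewrite diff_comp.
Qed.

Lemma derive_ebasis (R : realType) n (f : 'rV[R]_n -> R) (x v : 'rV[R]_n) :
  differentiable f x -> 'D_v f x = \sum_k v 0 k * 'D_(ebasis k) f x.
Proof.
move=> fD; rewrite deriveE // {1}[v]row_sum_delta linear_sum.
by apply: eq_bigr => k _; rewrite linearZ deriveE.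
Qed.

Lemma vderiveE (R : realType) m n (phi : 'rV[R]_m -> 'rV[R]_n) x v :
  differentiable phi x -> vderive v phi x = 'D_v phi x.
Proof.
move=> phiD; rewrite derive_mx; last exact: diff_derivable.
by apply/rowP => i; rewrite !mxE.
Qed.

(** * The metric, gradients and change of chart *)

Section MetricAlgebra.
Context {R : realType} {M : riemannian R}.
Implicit Types p : M.

(** A row of the left kernel of the metric is a tangent vector of zero length, hence zero by
    positivity. *)
Lemma gmet_unit p : gmet p \in unitmx.
Proof.
rewrite -row_free_unit -kermx_eq0; apply/eqP/row_matrixP => i.
rewrite row0; apply/eqP; apply: contrapT => /negP v0.
have := @gmet_pos _ M p _ v0; rewrite /gip.
have /sub_kermxP -> := row_sub i (kermx (gmet p)).
by rewrite mul0mx mxE ltxx.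
Qed.

Lemma invmx_gmet_sym p : (invmx (gmet p))^T = invmx (gmet p).
Proof. by rewrite trmx_inv gmet_sym. Qed.

Lemma gip_ge0 p (v : tangent p) : 0 <= gip v v.
Proof.
have [->|v0] := eqVneq v 0; first by rewrite /gip mul0mx mul0mx mxE.
exact/ltW/gmet_pos.
Qed.

(** The metric dual of a covector; for [a = df f] it is the gradient of [f]. *)
Definition sharp p (a : tangent p -> R) : tangent p :=
  (\row_j a (ebasis j)) *m invmx (gmet p).

Lemma sharpE p (a : tangent p -> R) i :
  sharp a 0 i = \sum_j invmx (gmet p) i j * a (ebasis j).
Proof.
rewrite mxE; apply: eq_bigr => j _.
by rewrite mxE mulrC -[in RHS]invmx_gmet_sym [in RHS]mxE.
Qed.

(** Raising the index is an isometry: one factor of the metric cancels one of the two inverses. This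
    links the Clifford relation to [cdf_norm]. *)
Lemma gip_sharp p (a : tangent p -> R) : gip (sharp a) (sharp a) = conorm2 a.
Proof.
rewrite /gip {1}/sharp mulmxKV ?gmet_unit // mxE /conorm2.
apply: eq_bigr => i _; rewrite mxE [_^T _ _]mxE sharpE mulr_sumr.
by apply: eq_bigr => j _; rewrite mulrC mulrAC.
Qed.

Lemma conorm2_ge0 p (a : tangent p -> R) : 0 <= conorm2 a.
Proof. by rewrite -gip_sharp gip_ge0. Qed.

End MetricAlgebra.

Section ChartChange.
Context {R : realType} {M : manifold R}.
Implicit Types (p : M) (c d : chart R (mdim M) M) (f : M -> R).

Lemma transition_differentiable c d p : atlas M c -> atlas M d ->
  cdom c p -> cdom d p -> differentiable (cmap d \o cinv c) (cmap c p).
Proof.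
move=> Mc Md cp dp; set phi := _ \o _.
have -> : phi = \sum_i (fun y => phi y 0 i *: (ebasis i : 'rV[R]_(mdim M))).
  by apply/funext => y; rewrite fct_sumE [LHS]row_sum_delta.
apply: differentiable_sum => i; apply: differentiableZl.
by apply: (atlas_compat Mc Md 1 i).1; exists p.
Qed.

(** Near the point, [f] read in [c] is [f] read in [d] after the transition map, so this is the
    chain rule. *)
Lemma chart_change c d f p v : atlas M c -> atlas M d -> cdom c p ->
  cdom d p -> differentiable (f \o cinv d) (cmap d p) ->
  'D_v (f \o cinv c) (cmap c p) =
  'D_(vderive v (cmap d \o cinv c) (cmap c p)) (f \o cinv d) (cmap d p).
Proof.
move=> Mc Md cp dp fD; have phiD := transition_differentiable Mc Md cp dp.
rewrite vderiveE //; set phi := _ \o _ in phiD *.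
have phix : phi (cmap c p) = cmap d p by rewrite /phi /= cmapK.
rewrite -phix in fD *; rewrite -derive_comp //.
apply: near_eq_derive; have := near_chart (cdom_open d) cp dp.
by apply: filterS => y [q [cq dq] <-]; rewrite /phi /= cmapK // cmapK.
Qed.

(** On the left both [df] and the frame go through the preferred chart at [p]; on the right that
    chart has disappeared, leaving a partial derivative in a fixed chart, which varies continuously
    with [p]. *)
Lemma df_cframe c f p i : atlas M c -> cdom c p -> fCk 1 setT f ->
  df f (cframe c i p) = 'D_(ebasis i) (f \o cinv c) (cmap c p).
Proof.
move=> Mc cp fC; have dp := chart_at_dom p.
rewrite (chart_change _ Mc (chart_at_atlas p)) //.
by apply: (fC _ (chart_at_atlas p)).1; exists p.
Qed.

Lemma df_ebasis f p (v : tangent p) : fCk 1 setT f ->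
  df f v = \sum_k v 0 k * df f (ebasis k : tangent p).
Proof.
move=> fC; apply: derive_ebasis.
apply: (fC _ (chart_at_atlas p)).1; exists p => //; split=> //.
exact: chart_at_dom.
Qed.

Definition frame_mx c p : 'M[R]_(mdim M) := \matrix_i cframe c i p.

(** The inverse consists of the components in [c] of the preferred basis: by the chain rule the
    product is the Jacobian of the identity, computed on each coordinate function of [c]. *)
Lemma frame_mx_unit c p : atlas M c -> cdom c p -> frame_mx c p \in unitmx.
Proof.
move=> Mc cp; have Md := chart_at_atlas p; have dp := chart_at_dom p.
suff : frame_mx c p *m (\matrix_k ccoord c (ebasis k : tangent p)) = 1%:M.
  by case/mulmx1_unit.
apply/matrixP => i j; pose f q := cmap c q 0 j.
have fD : differentiable (f \o cinv (chart_at p)) (cmap (chart_at p) p).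
  by apply: (atlas_compat Md Mc 1 j).1; exists p.
transitivity ('D_(ebasis i) (f \o cinv c) (cmap c p)).
  rewrite (chart_change _ Mc Md) // derive_ebasis // mxE.
  apply: eq_bigr => k _; congr (_ * _); first by rewrite [LHS]mxE.
  by rewrite [LHS]mxE [LHS]mxE.
have -> : 'D_(ebasis i) (f \o cinv c) (cmap c p) =
    'D_(ebasis i) (fun y : 'rV[R]_(mdim M) => y 0 j) (cmap c p).
  apply: near_eq_derive; have := near_chart openT cp I.
  by apply: filterS => y [q [cq _] <-]; rewrite /f /= cmapK.
have := @derive_mx _ _ _ _ id (cmap c p) (ebasis i) 
  (@derivable_id _ _ _ _).
rewrite derive_id => /rowP/(_ j); rewrite !mxE eqxx /= => <-.
by rewrite eq_sym.
Qed.

End ChartChange.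

Section GradientInFrame.
Context {R : realType} {M : riemannian R}.
Implicit Types (p : M) (c : chart R (mdim M) M) (f : M -> R).

Definition frame_gmet c p : 'M[R]_(mdim M) :=
  \matrix_(i, j) gip (cframe c i p) (cframe c j p).

Lemma frame_gmetE c p :
  frame_gmet c p = frame_mx c p *m gmet p *m (frame_mx c p)^T.
Proof.
apply/matrixP => i j.
transitivity ((row i (frame_mx c p) *m gmet p *m (frame_mx c p)^T) 0 j);
  last first.
  by rewrite -!row_mul mxE.
rewrite [LHS]mxE /gip [LHS]mxE [RHS]mxE rowK; apply: eq_bigr => k _.
by congr (_ * _); rewrite [LHS]mxE [RHS]mxE [RHS]mxE.
Qed.

Lemma frame_gmet_unit c p : atlas M c -> cdom c p ->
  frame_gmet c p \in unitmx.
Proof.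
move=> Mc cp.
by rewrite frame_gmetE !unitmx_mul unitmx_tr gmet_unit frame_mx_unit.
Qed.

(** Components of the gradient in the coordinate frame of [c], through the inverse Gram matrix of
    that frame. *)
Definition grad_coef c f p : 'rV[R]_(mdim M) :=
  (\row_j df f (cframe c j p)) *m invmx (frame_gmet c p).

(** With [A] the frame matrix, the Gram matrix is [A g A^T]; its inverse [B] satisfies
    [A^T B A = g^-1], which is the change of basis from the preferred frame to that of [c]. *)
Lemma sharp_frame c f p : atlas M c -> cdom c p -> fCk 1 setT f ->
  sharp (@df _ M f p) = \sum_i grad_coef c f p 0 i *: cframe c i p.
Proof.
move=> Mc cp fC; pose A := frame_mx c p; pose B := invmx (frame_gmet c p).
have ABA : A^T *m B *m A = invmx (gmet p).
  have : A *m (gmet p *m A^T *m B) = 1%:M.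
    by rewrite !mulmxA -frame_gmetE mulmxV // frame_gmet_unit.
  move=> /mulmx1C; rewrite -!mulmxA => /(congr1 (mulmx (invmx (gmet p)))).
  by rewrite mulKmx ?gmet_unit // mulmx1 mulmxA.
have -> : \sum_i grad_coef c f p 0 i *: cframe c i p = grad_coef c f p *m A.
  by rewrite mulmx_sum_row; apply: eq_bigr => i _; rewrite rowK.
have dfE : \row_j df f (cframe c j p) =
    (\row_j df f (ebasis j : tangent p)) *m A^T.
  apply/rowP => j; rewrite [LHS]mxE df_ebasis // [RHS]mxE.
  apply: eq_bigr => k _; rewrite mulrC; congr (_ * _); first by rewrite mxE.
  by rewrite [RHS]mxE [RHS]mxE.
by rewrite /sharp /grad_coef dfE -ABA !mulmxA.
Qed.

End GradientInFrame.

(** * Continuity of inverse matrices and of gradient components *)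

Section DetContinuity.
Context {R : realType} {T : topologicalType} (t : T).

Lemma eq_continuous_at (f g : T -> R) : f =1 g ->
  {for t, continuous f} -> {for t, continuous g}.
Proof. by move=> /funext ->. Qed.

Lemma continuous_at_sum (I : Type) (r : seq I) (P : pred I) (F : I -> T -> R) :
  (forall i, {for t, continuous (F i)}) ->
  {for t, continuous (fun q => \sum_(i <- r | P i) F i q)}.
Proof.
move=> FC; rewrite (_ : (fun q => _) = \sum_(i <- r | P i) F i); last first.
  by apply/funext => q; rewrite fct_sumE.
elim/big_ind: _ => // [|f g]; first exact: cst_continuous.
exact: continuousD.
Qed.

Lemma continuous_at_prod (I : Type) (r : seq I) (P : pred I) (F : I -> T -> R) :
  (forall i, {for t, continuous (F i)}) ->
  {for t, continuous (fun q => \prod_(i <- r | P i) F i q)}.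
Proof.
move=> FC; rewrite (_ : (fun q => _) = \prod_(i <- r | P i) F i); last first.
  by apply/funext => q; rewrite fct_prodE.
elim/big_ind: _ => // [|f g]; first exact: cst_continuous.
exact: continuousM.
Qed.

Lemma det_continuous_at n (A : T -> 'M[R]_n) :
  (forall i j, {for t, continuous (fun q => A q i j)}) ->
  {for t, continuous (fun q => \det (A q))}.
Proof.
move=> AC; apply: continuous_at_sum => s.
apply: continuousM; first exact: cst_continuous.
by apply: continuous_at_prod => i; exact: AC.
Qed.

(** By Cramer's rule the inverse is, near [t], the adjugate over a nonvanishing determinant, both
    polynomial in the entries. *)
Lemma invmx_continuous_at n (A : T -> 'M[R]_n) i j :
  (forall i j, {for t, continuous (fun q => A q i j)}) ->
  (\forall q \near t, A q \in unitmx) ->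
  {for t, continuous (fun q => invmx (A q) i j)}.
Proof.
move=> AC Au; pose f q := (\det (A q))^-1 * \adj (A q) i j.
have fC : {for t, continuous f}.
  apply: continuousM.
    apply: continuousV; last exact: det_continuous_at.
    by rewrite -unitfE -unitmxE; exact: nbhs_singleton Au.
  apply: (@eq_continuous_at
      (fun q => (-1) ^+ (j + i) * \det (row' j (col' i (A q))))) => [q|].
    by rewrite mxE.
  apply: continuousM; first exact: cst_continuous.
  apply: det_continuous_at => k k'.
  by apply: eq_continuous_at (AC (lift j k) (lift i k')) => q; rewrite !mxE.
apply: near_eq_continuous_at fC.
by apply: filterS Au => q Aq; rewrite /f /invmx Aq [RHS]mxE.
Qed.

End DetContinuity.

Section GradCoefContinuity.
Context {R : realType} {M : riemannian R}.
Implicit Types (p : M) (c : chart R (mdim M) M) (f : M -> R).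

Lemma df_cframe_continuous c f j : atlas M c -> fCk 1 setT f ->
  fCk 0 (cdom c) (fun p => df f (cframe c j p)).
Proof.
move=> Mc fC; apply/fCk0P => [|p cp]; first exact: cdom_open.
pose h := 'D_(ebasis j) (f \o cinv c) \o cmap c.
have hp : {for p, continuous h}.
  apply: continuous_comp; first exact: cmap_continuous.
  by apply: (fC c Mc).2; exists p.
apply: near_eq_continuous_at hp.
have : \forall q \near p, cdom c q.
  by apply: open_nbhs_nbhs; split=> //; exact: cdom_open.
by apply: filterS => q cq; rewrite df_cframe.
Qed.

Lemma grad_coef_continuous c f i : atlas M c -> fCk 1 setT f ->
  fCk 0 (cdom c) (fun p => grad_coef c f p 0 i).
Proof.
move=> Mc fC; apply/fCk0P => [|p cp]; first exact: cdom_open.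
pose F j q := df f (cframe c j q) * invmx (frame_gmet c q) j i.
apply: (eq_continuous_at (f := fun q => \sum_j F j q)) => [q|].
  by rewrite mxE; apply: eq_bigr => j _; rewrite mxE.
apply: continuous_at_sum => j; apply: continuousM.
  have := @df_cframe_continuous c f j Mc fC.
  by move/(fCk0P _ (cdom_open c)); apply.
apply: invmx_continuous_at => [k k'|].
  have := gmet_smooth Mc 0 k k'.
  move/(fCk0P _ (cdom_open c))/(_ p cp); apply: eq_continuous_at => q.
  by rewrite mxE.
have : \forall q \near p, cdom c q.
  by apply: open_nbhs_nbhs; split=> //; exact: cdom_open.
by apply: filterS => q cq; exact: frame_gmet_unit.
Qed.

End GradCoefContinuity.

(** * Clifford multiplication by gradients and the Leibniz rule for the Dirac operator *)

Section CliffordGradient.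
Context {R : realType} {G : lieGroup R} {M : gRiemannian G} (E : gClifford M).
Implicit Types (p : M) (f : M -> R[i]).

(** This is the commutator of the Dirac operator with multiplication by [f], as [dirac_leibniz]
    shows. Tangent vectors are real, so the gradients of the real and imaginary parts enter
    separately. *)
Definition cgrad f p (u : E p) : E p :=
  cliff (sharp (@df _ M (fun q => Re (f q)) p)) u +
  'i%C *: cliff (sharp (@df _ M (fun q => Im (f q)) p)) u.

Lemma cliff0 p (u : E p) : cliff (0 : tangent p) u = 0.
Proof.
have := cliff_linear_tangent (-1) 0 0 u.
by rewrite scaler0 addr0 rmorphN1 scaleN1r addNr.
Qed.

Lemma cliffD p (v : tangent p) (u w : E p) :
  cliff v (u + w) = cliff v u + cliff v w.
Proof. by have := cliff_linear v 1 u w; rewrite !scale1r. Qed.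

Lemma cliff_sum_tangent (I : Type) (r : seq I) p (k : I -> R)
    (v : I -> tangent p) (u : E p) :
  cliff (\sum_(i <- r) k i *: v i : tangent p) u =
  \sum_(i <- r) (k i)%:C *: cliff (v i) u.
Proof.
elim: r => [|i r IH]; first by rewrite !big_nil cliff0.
by rewrite !big_cons cliff_linear_tangent IH.
Qed.

(** The double sum has the shape of [dirac_op], so the Leibniz rule of the connection can be applied
    term by term. *)
Lemma cgradE f p (u : E p) : cgrad f u =
  \sum_i \sum_j (invmx (gmet p) i j)%:C *:
    cliff (ebasis i : tangent p) (cdf f (ebasis j : tangent p) *: u).
Proof.
have cliff_sharp (a : tangent p -> R) : cliff (sharp a) u =
    \sum_i \sum_j (invmx (gmet p) i j * a (ebasis j))%:C *:
      cliff (ebasis i : tangent p) u.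
  rewrite {1}[sharp a]row_sum_delta cliff_sum_tangent.
  by apply: eq_bigr => i _; rewrite sharpE rmorph_sum scaler_suml.
rewrite /cgrad !cliff_sharp scaler_sumr -big_split; apply: eq_bigr => i _ /=.
rewrite scaler_sumr -big_split; apply: eq_bigr => j _ /=.
rewrite cliffZ !scalerA -scalerDl; congr (_ *: _).
rewrite [X in _ = _ * X]complexE mulrDr !rmorphM; congr (_ + _).
by rewrite mulrCA.
Qed.

Lemma cgrad_linear f p : fib_linear (@cgrad f p).
Proof.
move=> a u v; rewrite /cgrad !cliff_linear !scalerDr !scalerA.
by rewrite ['i%C * a]mulrC addrACA.
Qed.

Lemma dirac_leibniz f (s : section E) p : cfCk 1 setT f -> secCk 1 s ->
  dirac_op (fun q => f q *: s q) p = cgrad f (s p) + f p *: dirac_op s p.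
Proof.
move=> fC sC; rewrite cgradE scaler_sumr -big_split; apply: eq_bigr => i _ /=.
rewrite scaler_sumr -big_split; apply: eq_bigr => j _ /=.
rewrite conn_leibniz // cliffD scalerDr; congr (_ + _).
by rewrite cliffZ !scalerA mulrC.
Qed.

Lemma conn0 p (v : tangent p) : conn (fun q => 0 : E q) v = 0.
Proof.
have zC : secCk 1 (fun q => 0 : E q) by move=> f _; exact: frameCk0.
have := conn_leibniz (cfCk_cst 1 setT 0) zC v.
rewrite cdf_cst !scale0r addr0 => <-; congr (conn _ v).
by apply: functional_extensionality_dep => q; rewrite scaler0.
Qed.

Lemma conn_sum (I : Type) (r : seq I) (s : I -> section E) p (v : tangent p) :
  (forall i, secCk 1 (s i)) ->
  conn (fun q => \sum_(i <- r) s i q) v = \sum_(i <- r) conn (s i) v.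
Proof.
move=> sC; elim: r => [|i r IH].
  rewrite big_nil -(conn0 v); congr (conn _ v).
  by apply: functional_extensionality_dep => q; rewrite big_nil.
rewrite big_cons -IH -conn_add //; last exact: secCk_sum.
congr (conn _ v).
by apply: functional_extensionality_dep => q; rewrite big_cons.
Qed.

Lemma cliff_sum (I : Type) (r : seq I) p (v : tangent p) (u : I -> E p) :
  cliff v (\sum_(i <- r) u i) = \sum_(i <- r) cliff v (u i).
Proof.
elim: r => [|i r IH]; last by rewrite !big_cons cliffD IH.
by rewrite !big_nil -[X in cliff _ X](scale0r 0) cliffZ scale0r.
Qed.

Lemma dirac_op_sum (I : Type) (r : seq I) (s : I -> section E) p :
  (forall i, secCk 1 (s i)) ->
  dirac_op (fun q => \sum_(i <- r) s i q) p = \sum_(i <- r) dirac_op (s i) p.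
Proof.
move=> sC; rewrite exchange_big; apply: eq_bigr => i _ /=.
rewrite exchange_big; apply: eq_bigr => j _ /=.
by rewrite conn_sum // cliff_sum scaler_sumr.
Qed.

(** Around each point one chart is fixed; there the gradient combines coordinate fields with
    continuous coefficients, and Clifford multiplication by those fields is smooth. [frameC0_local]
    glues the results. *)
Lemma cgrad_frame f (F : lframe E) j : frames E F -> cfCk 1 setT f ->
  frameCk F 0 (ldom F) (fun p => cgrad f (lsec F j p)).
Proof.
move=> EF [fR fI]; apply: frameC0_local => [|p Fp _]; first exact: ldom_open.
pose c := chart_at p; have Mc : atlas M c := chart_at_atlas p.
have Wo : open (cdom c `&` ldom F).
  by apply: openI; [exact: cdom_open | exact: ldom_open].
have coefC (h : M -> R) i : fCk 1 setT h ->
    cfCk 0 (cdom c `&` ldom F) (fun q => (grad_coef c h q 0 i)%:C).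
  move=> hC; split; last exact: fCk_cst.
  by apply: fCk_sub (@grad_coef_continuous _ _ c h i Mc hC) => q [].
have sharpC (h : M -> R) : fCk 1 setT h -> frameCk F 0 (cdom c `&` ldom F)
    (fun q => cliff (sharp (@df _ M h q)) (lsec F j q)).
  move=> hC; have := frameCk_sum (index_enum _) Wo (fun i =>
    frameCkM Wo (coefC h i hC) (cliff_smooth Mc EF 0 i j)).
  move=> [a [aC aE]]; exists a; split=> // q [cq Fq] Fq'.
  by rewrite -aE // (sharp_frame Mc) // cliff_sum_tangent.
exists (cdom c `&` ldom F); split=> //.
  by split=> //; exact: chart_at_dom.
apply: frameCkD => //; first exact: sharpC.
by apply: frameCkM => //; [exact: cfCk_cst | exact: sharpC].
Qed.

End CliffordGradient.

(** * Norm estimates through squared Hermitian norms *)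

Section HermitianSquare.
Context {R : realType} {M : manifold R} {E : hbundle M}.
Implicit Types (p : M).

Definition hsq p (u : E p) : R := Re (herm u u).

Lemma hsqE p (u : E p) : herm u u = (hsq u)%:C.
Proof.
have := herm_conj u u; rewrite /hsq; case: (herm u u) => a b /eqP.
rewrite eq_complex => /andP[_ /eqP /= bb].
by have -> : b = 0 by lra.
Qed.

Lemma hsq_ge0 p (u : E p) : 0 <= hsq u.
Proof. by rewrite -(lecR 0) -hsqE herm_ge0. Qed.

Lemma hermDl p (u v w : E p) : herm (u + v) w = herm u w + herm v w.
Proof. by have := herm_linear 1 u v w; rewrite scale1r mul1r. Qed.

Lemma hermDr p (u v w : E p) : herm w (u + v) = herm w u + herm w v.
Proof. by rewrite herm_conj hermDl rmorphD /= -!herm_conj. Qed.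

Lemma hsqD p (u v : E p) : hsq (u + v) = hsq u + hsq v + 2 * Re (herm u v).
Proof.
rewrite /hsq hermDl !hermDr (herm_conj u v) !cReD.
by case: (herm u v) => a b /=; ring.
Qed.

Lemma hsqZ p a (u : E p) : hsq (a *: u) = (Re a ^+ 2 + Im a ^+ 2) * hsq u.
Proof.
have hZl (b : R[i]) (v w : E p) : herm (b *: v) w = b * herm v w.
  by have := herm_linear b v 0 w; rewrite herm0l !addr0.
rewrite {1}/hsq hZl herm_conj hZl hsqE.
by case: a => a b /=; ring.
Qed.

Lemma Re_herm_ge p (u v : E p) : - (hsq u + hsq v) <= 2 * Re (herm u v).
Proof. by have := hsq_ge0 (u + v); rewrite hsqD; lra. Qed.

(** The parallelogram law with the square of [u - v] dropped. *)
Lemma hsqD_le p (u v : E p) : hsq (u + v) <= 2 * hsq u + 2 * hsq v.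
Proof.
have := hsq_ge0 (u - v); rewrite -scaleN1r !hsqD hsqZ.
have -> : Re (herm u (-1 *: v)) = - Re (herm u v).
  rewrite herm_conj; have := herm_linear (-1) v 0 u.
  rewrite herm0l !addr0 => ->; rewrite (herm_conj v u).
  by case: (herm v u) => a b /=; ring.
by move=> /=; lra.
Qed.

Lemma hsq_sum_le (I : Type) (r : seq I) p (u : I -> E p) :
  hsq (\sum_(i <- r) u i) <= 2 ^+ size r * \sum_(i <- r) hsq (u i).
Proof.
elim: r => [|i r IH]; first by rewrite !big_nil /hsq herm0l mulr0.
rewrite !big_cons; apply: le_trans (hsqD_le _ _) _.
have r1 : (1 : R) <= 2 ^+ size r by rewrite exprn_ege1 // ler1n.
have := ler_wpM2r (hsq_ge0 (u i)) r1.
by move: IH => /=; rewrite exprS; nra.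
Qed.

End HermitianSquare.

Section TensorHermitianSquare.
Context {R : realType} {M : manifold R} {N : nat} (E : hbundle M).
Local Notation T := (tensor_hbundle N E).

Lemma hsq_tensor p (u : T p) :
  hsq u = \sum_x hsq ((u : {ffun 'I_N -> E p}) x).
Proof.
apply: complexI; rewrite -hsqE rmorph_sum.
by apply: eq_bigr => x _; rewrite hsqE.
Qed.

(** Passes from entrywise bounds to a bound on the whole block operator: each of the [N] rows costs
    [2 ^+ N * e]. The constant is the same at every point, so decay of the entries gives uniform
    decay. *)
Lemma hsq_tensor_le p (e : R) (w : 'I_N -> 'I_N -> E p -> E p) (u : T p) :
  (forall x y v, hsq (w x y v) <= e * hsq v) ->
  hsq ([ffun x => \sum_y w x y ((u : {ffun 'I_N -> E p}) y)] : T p) <=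
  N%:R * 2 ^+ N * e * hsq u.
Proof.
move=> we; rewrite !hsq_tensor.
have -> : N%:R * 2 ^+ N * e = \sum_(x < N) (2 ^+ N * e).
  by rewrite sumr_const card_ord -mulrA mulr_natl.
rewrite mulr_suml; apply: ler_sum => x _.
rewrite ffunE; apply: le_trans (hsq_sum_le _ _) _.
rewrite [index_enum _]unlock -enumT size_enum_ord.
rewrite -mulrA ler_wpM2l ?exprn_ge0 //.
by rewrite mulr_sumr; apply: ler_sum => y _; exact: we.
Qed.

End TensorHermitianSquare.

Section CliffordEstimates.
Context {R : realType} {G : lieGroup R} {M : gRiemannian G} {E : gClifford M}.
Implicit Types (p : M) (f : M -> R[i]).

Lemma hsq_cliff p (v : tangent p) (u : E p) :
  hsq (cliff v u) = gip v v * hsq u.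
Proof.
apply: complexI; rewrite -hsqE cliff_skew cliff_sqr hermZr hsqE.
have -> : (- (gip v v)%:C)^* = - (gip v v)%:C :> R[i].
  by rewrite rmorphN; congr (- _); exact: conjc_real.
by rewrite mulNr opprK rmorphM.
Qed.

Lemma hsq_cgrad f p (u : E p) :
  hsq (cgrad f u) <= 2 * cdf_norm f p ^+ 2 * hsq u.
Proof.
apply: le_trans (hsqD_le _ _) _.
rewrite hsqZ !hsq_cliff !gip_sharp /= sqr_sqrtr; last first.
  by apply: addr_ge0; exact: conorm2_ge0.
by rewrite le_eqVlt; apply/orP; left; apply/eqP; ring.
Qed.

Lemma sharpN p (a : tangent p -> R) :
  sharp (fun v => - a v) = - sharp a.
Proof.
by rewrite /sharp -mulNmx; congr (_ *m _); apply/rowP => j; rewrite !mxE.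
Qed.

Lemma cliffNl p (v : tangent p) (u : E p) :
  cliff (- v : tangent p) u = - cliff v u.
Proof.
have := cliff_linear_tangent (-1) v 0 u.
by rewrite addr0 cliff0 addr0 rmorphN1 !scaleN1r.
Qed.

(** Clifford multiplication is skew and the scalar ['i] is conjugated, so the adjoint carries a
    minus sign and the conjugate function. *)
Lemma herm_cgrad f p (u w : E p) : cfCk 1 setT f ->
  herm (cgrad f u) w = - herm u (cgrad (fun q => (f q)^*) w).
Proof.
move=> fC; rewrite /cgrad.
have -> : (fun q => Re (f q)^*) = (fun q => Re (f q)).
  by apply/funext => q; case: (f q).
have -> : @df _ M (fun q => Im (f q)^*) p =
    fun v => - @df _ M (fun q => Im (f q)) p v.
  apply/funext => v; have [_ fi] := cfCk1_cderivable v fC (I : setT p).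
  rewrite /df -(deriveN fi); congr ('D_v _ _).
  by apply/funext => x; rewrite !fctE /=; case: (f _).
rewrite sharpN cliffNl hermDl hermDr hermZl.
have conjNi : (- 'i%C)^* = 'i%C :> R[i].
  by apply/eqP; rewrite eq_complex /= oppr0 opprK !eqxx.
by rewrite scalerN -scaleNr hermZr conjNi !cliff_skew mulrN opprD.
Qed.

End CliffordEstimates.

(** * Boundedness and decay of gradients at infinity in the orbit space *)

Section CocompactControl.
Context {R : realType} {G : lieGroup R} {M : gRiemannian G}.

Lemma cocompact_forall (I : finType) (Q : I -> M -> Prop) :
  (forall i, exists K : set M, cocompact K /\ forall p, ~ K p -> Q i p) ->
  exists K : set M, cocompact K /\ forall p, ~ K p -> forall i, Q i p.
Proof.
move=> /choice[K KP].
exists (\big[setU/set0]_i K i); split=> [|p Kp i].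
  elim/big_ind: _ => [||i _]; last exact: (KP i).1.
    by rewrite /cocompact image_set0 closure0; exact: compact0.
  exact: cocompactU.
by apply: (KP i).2 => Kip; apply: Kp; rewrite (bigD1 i) //=; left.
Qed.

(** Off a cocompact [K] the values are below 1. On [K] they are values of the induced continuous
    function on the orbit space, over the compact closure of the image of [K]. *)
Lemma C0G_bounded (h : M -> R) : C0G (fun p => (h p)%:C) ->
  exists c : R, forall p, `|h p| <= c.
Proof.
move=> [[hC _] hG h0]; have {}hG g p : h (act g p) = h p.
  by apply: complexI; exact: hG.
have [K [Kc hK]] := h0 1 ltr01.
have pi_h p q : orbit_proj p = orbit_proj q -> h p = h q.
  by move=> /eqquotP /asboolP[g ->]; rewrite hG.
pose hq : orbit_space M -> R := h \o repr.
have hqE p : hq (orbit_proj p) = h p by apply: pi_h; exact: reprK.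
have hqC : continuous hq.
  by apply: repr_comp_continuous => // p q /eqP /pi_h ->.
have /compact_bounded := continuous_compact (continuous_subspaceT hqC) Kc.
move=> [a [_ aP]].
(* Boundedness provides a bound by every number strictly above [a], hence [a + 1]. *)
exists (Num.max 1 (a + 1)) => p; rewrite le_max.
have [Kp|/hK] := pselect (K p); last first.
  by rewrite normc_def /= ltcR expr0n /= addr0 sqrtr_sqr => /ltW ->.
apply/orP; right; rewrite -hqE; apply: (aP (a + 1)); first by rewrite ltrDl.
exists (orbit_proj p) => //; apply: subset_closure.
by exists p.
Qed.

End CocompactControl.

Section GradientDecay.
Context {R : realType} {G : lieGroup R} {M : gRiemannian G} (E : gClifford M).
Implicit Types f : M -> R[i].

(** The global bound serves the boundedness of the anticommutator, the decay serves positivity.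
    Phrasing both through [cgrad] makes them pass directly to affine expressions in [f]. *)
Definition grad_vanishing f : Prop :=
  (exists c : R, forall p (u : E p), hsq (cgrad f u) <= c * hsq u) /\
  forall e : R, 0 < e -> exists K : set M, cocompact K /\
    forall p, ~ K p -> forall u : E p, hsq (cgrad f u) <= e * hsq u.

Lemma CgsmoothG_grad_vanishing f : CgsmoothG f -> grad_vanishing f.
Proof.
move=> [_ _ f0]; have n0 p : 0 <= cdf_norm f p by exact: sqrtr_ge0.
split=> [|e e0].
  have [c cP] := C0G_bounded f0; exists (2 * c ^+ 2) => p u.
  apply: le_trans (hsq_cgrad f u) _; rewrite ler_wpM2r ?hsq_ge0 //.
  have := cP p; rewrite ger0_norm // => nc.
  by rewrite ler_wpM2l // lerXn2r ?nnegrE // (le_trans _ nc).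
(* For a norm [n < d <= 1] the square satisfies [2 * n ^+ 2 <= 2 * d <= e]. *)
have [_ _ fe] := f0; pose d := Num.min 1 (e / 2).
have d0 : 0 < d by rewrite lt_min ltr01 divr_gt0.
have d1 : d <= 1 by rewrite ge_min lexx.
have de : 2 * d <= e.
  have : d <= e / 2 by rewrite ge_min lexx orbT.
  by lra.
have [K [Kc Ke]] := fe d d0; exists K; split=> // p /Ke np u.
apply: le_trans (hsq_cgrad f u) _; rewrite ler_wpM2r ?hsq_ge0 //.
move: np; rewrite normc_def /= expr0n addr0 sqrtr_sqr ltcR ger0_norm // => np.
by have := n0 p; nra.
Qed.

Lemma cgrad_affine (k a : R[i]) f p (u : E p) : cfCk 1 setT f ->
  cgrad (fun q => k + a * f q) u = a *: cgrad f u.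
Proof.
move=> fC; rewrite !cgradE scaler_sumr; apply: eq_bigr => i _.
rewrite scaler_sumr; apply: eq_bigr => j _.
rewrite cdf_affine; last exact: cfCk1_cderivable fC I.
by rewrite -scalerA cliffZ scalerA mulrC -scalerA.
Qed.

Lemma grad_vanishing_affine (k a : R[i]) f : cfCk 1 setT f ->
  grad_vanishing f -> grad_vanishing (fun q => k + a * f q).
Proof.
move=> fC [[c cP] fe]; pose A := Re a ^+ 2 + Im a ^+ 2.
have A0 : 0 <= A by rewrite addr_ge0 // sqr_ge0.
split=> [|e e0].
  exists (A * c) => p u; rewrite cgrad_affine // hsqZ -mulrA.
  by rewrite ler_wpM2l.
(* [A] is zero when [a] is, so the division is by [A + 1]. *)
have A1 : 0 < A + 1 by rewrite ltr_wpDl.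
have [K [Kc Ke]] := fe (e / (A + 1)) (divr_gt0 e0 A1).
exists K; split=> // p /Ke pe u; rewrite cgrad_affine // hsqZ.
apply: le_trans (ler_wpM2l A0 (pe u)) _; rewrite mulrA ler_wpM2r ?hsq_ge0 //.
by rewrite mulrCA ler_piMr ?(ltW e0) // ler_pdivrMr // mul1r lerDl.
Qed.

End GradientDecay.

Section MatrixAction.
Context {R : realType} {N : nat} {V : lmodType R[i]}.
Implicit Types (A B : 'M[R[i]]_N) (u : {ffun 'I_N -> V}).

Lemma mxactDl A B u : mxact (A + B) u = mxact A u + mxact B u.
Proof.
apply/ffunP => x; rewrite !ffunE -big_split /=.
by apply: eq_bigr => y _; rewrite mxE scalerDl.
Qed.

Lemma mxact1 u : mxact 1%:M u = u.
Proof.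
apply/ffunP => x; rewrite ffunE (bigD1 x) //= mxE eqxx scale1r.
rewrite big1 ?addr0 // => y yx.
by rewrite mxE eq_sym (negbTE yx) scale0r.
Qed.

Lemma mxactM A B u : mxact A (mxact B u) = mxact (A *m B) u.
Proof.
apply/ffunP => x; rewrite !ffunE.
under eq_bigr do rewrite ffunE scaler_sumr.
rewrite exchange_big; apply: eq_bigr => y _ /=.
by rewrite mxE scaler_suml; apply: eq_bigr => z _; rewrite scalerA.
Qed.

End MatrixAction.

(** * Admissibility of a potential given by an abstract matrix [S] of functions *)

Section CalliasType.
Context {R : realType} {G : lieGroup R} {M : gRiemannian G}
  (E0 : gClifford M) (l : nat) (S : 'M[M -> R[i]]_(l + l)).
Local Notation E := (doubled_bundle E0 l).
Local Notation comps p u := (u : {ffun 'I_(l + l) -> E0 p}).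

Hypothesis S_C1 : forall x y, cfCk 1 setT (S x y).
Hypothesis S_inv : forall x y, Defs.invariant (S x y).
Hypothesis S_grad : forall x y, grad_vanishing E0 (S x y).
Hypothesis S_herm : forall p x y, S x y p = (S y x p)^*.
Hypothesis S_odd : forall p x y,
  S x y p * sgn_ord y = - (sgn_ord x * S x y p).
Hypothesis S_swap : forall p x y, S (swap_ord x) y p = - S x (swap_ord y) p.
Hypothesis S_sqr : forall x y (e : R), 0 < e ->
  exists K : set M, cocompact K /\
    forall p, ~ K p -> `|(mx_at S p *m mx_at S p - 1%:M) x y| < e%:C.

Definition potential : endo E := fun p u => mxact (mx_at S p) u.

(** The part of [D Phi] in which the derivative falls on [S]; the swap contained in [D] sends row
    [x] to row [swap_ord x]. *)
Definition anticommutator : endo E := fun p u =>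
  [ffun x => \sum_y cgrad (S (swap_ord x) y) (comps p u y)].

Lemma potentialE p (u : E p) x :
  comps p (potential u) x = \sum_y S x y p *: comps p u y.
Proof. by rewrite ffunE; apply: eq_bigr => y _; rewrite mxE. Qed.

Lemma anticommutatorE p (u : E p) x : comps p (anticommutator u) x =
  \sum_y cgrad (S (swap_ord x) y) (comps p u y).
Proof. by rewrite ffunE. Qed.

Lemma lsec_Ck (F : lframe E0) k j : frames E0 F ->
  frameCk F k (ldom F) (lsec F j).
Proof. by move=> EF; exact: frames_compat. Qed.

Lemma potential_C1 : endoCk 1 potential.
Proof.
split=> [p a u v|_ [f Ef ->] [y j]].
  apply/ffunP => x; rewrite !(potentialE, ffunE) scaler_sumr -big_split.
  by apply: eq_bigr => y _; rewrite !ffunE scalerDr !scalerA mulrC.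
apply/tframeCk => x.
have -> : (fun p => comps p (potential (tsec (y, j) p : E p)) x) =
    fun p => S x y p *: lsec f j p.
  apply: functional_extensionality_dep => p.
  rewrite potentialE (bigD1 y) //= ffunE eqxx big1 ?addr0 // => z zy.
  by rewrite ffunE (negbTE zy) scaler0.
apply: frameCkM; [exact: ldom_open | | exact: lsec_Ck].
exact: cfCk_sub (S_C1 x y).
Qed.

Lemma potential_odd p (u : E p) :
  potential (grading u) = - grading (potential u).
Proof.
apply/ffunP => x; rewrite [RHS]ffunE dgradingE !potentialE scaler_sumr -sumrN.
apply: eq_bigr => y _.
by rewrite dgradingE !scalerA S_odd scaleNr.
Qed.

Lemma potential_invariant : invariant_endo potential.
Proof.
move=> g p u; apply/ffunP => x; rewrite potentialE [LHS]ffunE potentialE.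
have gact_sum (I : Type) (r : seq I) (w : I -> E0 p) :
    gact g (\sum_(i <- r) w i) = \sum_(i <- r) gact g (w i).
  elim: r => [|i r IH]; first by rewrite !big_nil gact0.
  by rewrite !big_cons -IH -[w i]scale1r gact_linear !scale1r.
rewrite gact_sum; apply: eq_bigr => y _; rewrite ffunE S_inv.
exact: (fib_linearZ (@gact_linear _ _ _ E0 g p)).
Qed.

Lemma herm_sumr (F : hbundle M) (I : finType) p (w : I -> F p) (u : F p) :
  herm u (\sum_i w i) = \sum_i herm u (w i).
Proof. by elim/big_rec2: _ => [|i y v _ <-]; [exact: herm0r|exact: hermDr]. Qed.

Lemma herm_suml1 (F : hbundle M) (I : finType) p (w : I -> F p) (u : F p) :
  herm (\sum_i w i) u = \sum_i herm (w i) u.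
Proof. by elim/big_rec2: _ => [|i y v _ <-]; [exact: herm0l|exact: hermDl]. Qed.

Lemma potential_self_adjoint p (u v : E p) :
  herm (potential u) v = herm u (potential v).
Proof.
transitivity (\sum_x \sum_y S x y p * herm (comps p u y) (comps p v x)).
  apply: eq_bigr => x _; rewrite potentialE herm_suml1.
  by apply: eq_bigr => y _; rewrite hermZl.
rewrite exchange_big; apply: eq_bigr => y _ /=; rewrite potentialE herm_sumr.
by apply: eq_bigr => x _; rewrite hermZr -S_herm.
Qed.

Lemma anticommutator_C0 : endoCk 0 anticommutator.
Proof.
split=> [p a u v|_ [f Ef ->] [y j]].
  apply/ffunP => x; rewrite !(anticommutatorE, ffunE) scaler_sumr -big_split.
  by apply: eq_bigr => y _; rewrite !ffunE cgrad_linear.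
apply/tframeCk => x.
have -> : (fun p => comps p (anticommutator (tsec (y, j) p : E p)) x) =
    fun p => cgrad (S (swap_ord x) y) (lsec f j p).
  apply: functional_extensionality_dep => p.
  rewrite anticommutatorE (bigD1 y) //= ffunE eqxx big1 ?addr0 // => z zy.
  rewrite ffunE (negbTE zy).
  have := fib_linearZ (@cgrad_linear _ _ _ E0 (S (swap_ord x) z) p) 0 0.
  by rewrite !scale0r.
exact: cgrad_frame.
Qed.

(** In [D Phi] the Leibniz rule leaves, besides the gradients, the terms [S (swap_ord x) y] times
    the Dirac operator on component [y]. Reindexed by the swap, [Phi D] has [S x (swap_ord y)] there
    instead, and [S_swap] makes the two cancel. *)
Lemma anticommutatorP :
  anticommutator_is (E := E) (off_diagonal_op (dirac_op (E := E0)))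
    potential anticommutator.
Proof.
move=> s sC p; apply/ffunP => x; rewrite [LHS]ffunE anticommutatorE.
have sxC y : @secCk _ _ E0 1 (fun q => comps q (s q) y) by exact: dsecCk.
rewrite potentialE swap_mxactE ffunE.
have -> : (fun q => comps q (potential (s q)) (swap_ord x)) =
    fun q => \sum_y S (swap_ord x) y q *: comps q (s q) y.
  by apply: functional_extensionality_dep => q; rewrite potentialE.
rewrite dirac_op_sum; last by move=> y; apply: secCkM.
rewrite (reindex_inj (inv_inj (@swap_ordK l))) -big_split /=.
apply: eq_bigr => y _; rewrite swap_mxactE ffunE swap_ordK dirac_leibniz //.
by rewrite S_swap scaleNr addrCA subrr addr0.
Qed.

(** The minus sign of [herm_cgrad] cancels against that of [S_swap], applied after conjugation has
    transposed the entry of [S]. *)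
Lemma anticommutator_self_adjoint p (u v : E p) :
  herm (anticommutator u) v = herm u (anticommutator v).
Proof.
transitivity (\sum_x \sum_y
    herm (cgrad (S (swap_ord x) y) (comps p u y)) (comps p v x)).
  by apply: eq_bigr => x _; rewrite anticommutatorE herm_suml1.
rewrite exchange_big; apply: eq_bigr => y _ /=.
rewrite anticommutatorE herm_sumr; apply: eq_bigr => x _.
rewrite herm_cgrad // [X in cgrad X _](_ : _ =
    fun q => 0 + -1 * S (swap_ord y) x q).
  rewrite cgrad_affine // scaleN1r -scaleN1r hermZr.
  by rewrite rmorphN1 mulN1r opprK.
apply/funext => q; rewrite -S_herm add0r mulN1r.
by rewrite [in RHS]S_swap opprK.
Qed.

Lemma hsq_anticommutator_le p (e : R) (u : E p) :
  (forall x y (v : E0 p), hsq (cgrad (S x y) v) <= e * hsq v) ->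
  hsq (anticommutator u) <= (l + l)%:R * 2 ^+ (l + l) * e * hsq u.
Proof.
move=> Se.
exact: (@hsq_tensor_le _ _ _ E0 p e
  (fun x y => @cgrad _ _ _ E0 (S (swap_ord x) y) p) u).
Qed.

Lemma anticommutator_bounded : bounded_endo anticommutator.
Proof.
have /choice[c cP] (z : 'I_(l + l) * 'I_(l + l)) : exists c : R,
    forall p (u : E0 p), hsq (cgrad (S z.1 z.2) u) <= c * hsq u.
  exact: (S_grad z.1 z.2).1.
pose C := \sum_z `|c z|; pose k : R := (l + l)%:R * 2 ^+ (l + l) * C.
have k0 : 0 <= k by rewrite !mulr_ge0 ?exprn_ge0 // sumr_ge0.
exists (Num.sqrt k) => p u; rewrite /hnorm -sqrtrM // ler_sqrt; last first.
  by rewrite mulr_ge0 // hsq_ge0.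
apply: hsq_anticommutator_le => x y v; apply: le_trans (cP (x, y) p v) _.
rewrite ler_wpM2r ?hsq_ge0 // (le_trans (ler_norm _)) // /C.
by rewrite (bigD1 (x, y)) //= lerDl sumr_ge0.
Qed.

Lemma potential_sqr p (u : E p) :
  potential (potential u) = u + mxact (mx_at S p *m mx_at S p - 1%:M) u.
Proof.
rewrite /potential mxactM -[X in mxact X _ = _](subrK 1%:M) mxactDl mxact1.
exact: addrC.
Qed.

Lemma potential_positive : exists (K : set M) (C : R), [/\ cocompact K, 0 < C &
  forall p, ~ K p -> forall u : E p,
    C%:C * herm u u <= herm (anticommutator u + potential (potential u)) u].
Proof.
pose k : R := (l + l)%:R * 2 ^+ (l + l).
have k0 : 0 <= k by rewrite mulr_ge0 ?exprn_ge0.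
(* Each of the two parts of [w] below gets squared norm at most [k * e <= 1/16] times that of [u],
   so that of [w] is at most [2 * (1/16 + 1/16) = 1/4]. The summand 1 covers [k = 0], which occurs
   for [l = 0], and gives [e <= 1]. *)
pose e : R := (16 * (k + 1))^-1.
have e0 : 0 < e by rewrite invr_gt0; lra.
have ke : k * e <= 16^-1.
  by rewrite /e invfM mulrCA ler_piMr // ?invr_ge0 // ler_pdivrMr; lra.
have e1 : e <= 1 by rewrite /e invf_le1; lra.
pose small (z : 'I_(l + l) * 'I_(l + l)) (p : M) : Prop :=
  (forall u : E0 p, hsq (cgrad (S z.1 z.2) u) <= e * hsq u) /\
  `|(mx_at S p *m mx_at S p - 1%:M) z.1 z.2| < e%:C.
have small_off z : exists K : set M,
    cocompact K /\ forall p, ~ K p -> small z p.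
  case: z => [x y]; have [K1 [K1c K1P]] := (S_grad x y).2 e e0.
  have [K2 [K2c K2P]] := S_sqr x y e0.
  exists (K1 `|` K2); split; first exact: cocompactU.
  move=> p Kp; split=> [u|]; first by apply: K1P => K1p; apply: Kp; left.
  by apply: K2P => K2p; apply: Kp; right.
have [K [Kc Ksmall]] := cocompact_forall small_off.
(* [Re <w, u> >= - (|w|^2 + |u|^2) / 2], and [|w|^2 <= |u|^2 / 4]. *)
exists K, (3 / 8); split=> [//||p]; first by lra.
move=> /Ksmall psmall u; pose Z := mx_at S p *m mx_at S p - 1%:M.
pose w : E p := anticommutator u + mxact Z u.
have hw : hsq w <= 4^-1 * hsq u.
  have hB : hsq (anticommutator u) <= k * e * hsq u.
    by apply: hsq_anticommutator_le => x y; exact: (psmall (x, y)).1.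
  have hZ : hsq (mxact Z u : E p) <= k * e * hsq u.
    apply: (@hsq_tensor_le _ _ _ E0 p e (fun x y v => Z x y *: v) u) => x y v.
    rewrite hsqZ ler_wpM2r ?hsq_ge0 //.
    have := (psmall (x, y)).2; rewrite normc_def ltcR /= -/Z => /ltW Ze.
    (* The entries of [Z] themselves, not their squares, are below [e]; as [e <= 1], the squares are
       too. *)
    apply: le_trans (_ : e ^+ 2 <= e); last by rewrite expr2 ler_piMl // ltW.
    rewrite -[leLHS]sqr_sqrtr ?addr_ge0 ?sqr_ge0 //.
    by rewrite lerXn2r ?nnegrE ?sqrtr_ge0 // ltW.
  have u0 := hsq_ge0 u; have := hsqD_le (anticommutator u) (mxact Z u : E p).
  by rewrite -/w; have := ler_wpM2r u0 ke; lra.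
have -> : anticommutator u + potential (potential u) = u + w.
  by rewrite potential_sqr /w addrCA.
(* To compare in [R[i]], the right-hand side must be known to be real; this is where
   self-adjointness of the anticommutator is used. *)
have real_w : herm (u + w) u = (Re (herm (u + w) u))%:C.
  have wE : u + w = anticommutator u + potential (potential u).
    by rewrite potential_sqr /w addrCA.
  have : herm (u + w) u = (herm (u + w) u)^*.
    rewrite -herm_conj wE hermDl hermDr anticommutator_self_adjoint.
    by rewrite !potential_self_adjoint.
  case: (herm _ _) => a b /eqP; rewrite eq_complex => /andP[_ /eqP /= bb].
  by have -> : b = 0 by lra.
rewrite real_w hsqE -rmorphM lecR hermDl cReD -/(hsq u).
(* The constant is [1 - (1/4 + 1) / 2 = 3/8]. *)
have := Re_herm_ge w u; have := hsq_ge0 u.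
by lra.
Qed.

Lemma callias_type_admissible : g_admissible (E := E)
  (off_diagonal_op (dirac_op (E := E0))) potential.
Proof.
split.
- exact: potential_C1.
- exact: potential_odd.
- exact: potential_invariant.
- exact: potential_self_adjoint.
exists anticommutator; split.
- exact: anticommutator_C0.
- exact: anticommutatorP.
- exact: anticommutator_bounded.
exact: potential_positive.
Qed.

End CalliasType.

(** * The concrete matrix built from [P] *)

Section DoubledIndices.
Context {R : realType} (l : nat).

Lemma sgn_lshift (a : 'I_l) : sgn_ord (lshift l a) = 1 :> R[i].
Proof. by rewrite /sgn_ord (unsplitK (inl a)). Qed.

Lemma sgn_rshift (a : 'I_l) : sgn_ord (rshift l a) = -1 :> R[i].
Proof. by rewrite /sgn_ord (unsplitK (inr a)). Qed.

Lemma swap_lshift (a : 'I_l) : swap_ord (lshift l a) = rshift l a.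
Proof. by rewrite /swap_ord (unsplitK (inl a)). Qed.

Lemma swap_rshift (a : 'I_l) : swap_ord (rshift l a) = lshift l a.
Proof. by rewrite /swap_ord (unsplitK (inr a)). Qed.

End DoubledIndices.

Section CalliasMatrix.
Context {R : realType} {G : lieGroup R} {M : gRiemannian G} {l : nat}.
Variable P : 'M[M -> R[i]]_l.

Definition callias_mx (p : M) : 'M[R[i]]_(l + l) :=
  'i%C *: block_mx 0 (1%:M - 2 *: mx_at P p) (2 *: mx_at P p - 1%:M) 0.

Definition callias_fun_mx : 'M[M -> R[i]]_(l + l) :=
  \matrix_(x, y) (fun p => callias_mx p x y).

Lemma callias_fun_mxE x y : callias_fun_mx x y = fun p => callias_mx p x y.
Proof. by rewrite mxE. Qed.

Lemma mx_at_callias p : mx_at callias_fun_mx p = callias_mx p.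
Proof. by apply/matrixP => x y; rewrite !mxE. Qed.

Lemma callias_ul p a b : callias_mx p (lshift l a) (lshift l b) = 0.
Proof. by rewrite mxE block_mxEul mxE mulr0. Qed.

Lemma callias_dr p a b : callias_mx p (rshift l a) (rshift l b) = 0.
Proof. by rewrite mxE block_mxEdr mxE mulr0. Qed.

Lemma callias_ur p a b : callias_mx p (lshift l a) (rshift l b) =
  'i%C * ((a == b)%:R - 2 * P a b p).
Proof. by rewrite mxE block_mxEur !mxE. Qed.

Lemma callias_dl p a b : callias_mx p (rshift l a) (lshift l b) =
  - ('i%C * ((a == b)%:R - 2 * P a b p)).
Proof. by rewrite mxE block_mxEdl !mxE -mulrN opprB. Qed.

Definition callias_mxE := (callias_ul, callias_ur, callias_dl, callias_dr).

(** Regularity, invariance and gradient decay all pass from the entries of [P] to affine expressions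
    in them, so this shape is all that those three properties require. The zero blocks take
    [k = a = 0]. *)
Lemma callias_affine x y : exists k a b c,
  callias_fun_mx x y = fun p => k + a * P b c p.
Proof.
rewrite callias_fun_mxE.
case: (split_ordP x) => a ->; case: (split_ordP y) => b ->.
- by exists 0, 0, a, b; apply/funext => p; rewrite callias_mxE mul0r addr0.
- exists ('i%C * (a == b)%:R), (- 'i%C * 2), a, b; apply/funext => p.
  by rewrite callias_mxE mulrBr mulNr mulNr mulrA.
- exists (- ('i%C * (a == b)%:R)), ('i%C * 2), a, b; apply/funext => p.
  by rewrite callias_mxE mulrBr opprB addrC mulrA.
- by exists 0, 0, a, b; apply/funext => p; rewrite callias_mxE mul0r addr0.
Qed.

Lemma callias_odd p x y :
  callias_mx p x y * sgn_ord y = - (sgn_ord x * callias_mx p x y).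
Proof.
case: (split_ordP x) => a ->; case: (split_ordP y) => b ->;
  rewrite !callias_mxE ?sgn_lshift ?sgn_rshift.
- by rewrite mulr0 mul0r oppr0.
- by rewrite mulrN1 mul1r.
- by rewrite mulr1 mulN1r opprK.
- by rewrite mulr0 mul0r oppr0.
Qed.

Lemma callias_swap p x y :
  callias_mx p (swap_ord x) y = - callias_mx p x (swap_ord y).
Proof.
by case: (split_ordP x) => a ->; case: (split_ordP y) => b ->;
  rewrite !(swap_lshift, swap_rshift) !callias_mxE ?oppr0 ?opprK.
Qed.

(** The two off-diagonal blocks have opposite signs, which conjugation of the factor ['i]
    compensates; self-adjointness of [P] does the rest. *)
Lemma callias_herm p x y : P = fun_adjmx P ->
  callias_mx p x y = (callias_mx p y x)^*.
Proof.
move=> PE; have PH a b : (P a b p)^* = P b a p.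
  by rewrite [in RHS]PE !mxE.
have conj_entry a b : ('i%C * ((b == a)%:R - 2 * P b a p))^* =
    - ('i%C * ((a == b)%:R - 2 * P a b p)).
  rewrite rmorphM rmorphB rmorphM !rmorph_nat /= PH eq_sym -[RHS]mulNr.
  by congr (_ * _); apply/eqP; rewrite eq_complex /= oppr0 !eqxx.
case: (split_ordP x) => a ->; case: (split_ordP y) => b ->;
  rewrite !callias_mxE.
- by rewrite rmorph0.
- by rewrite rmorphN /= conj_entry opprK.
- by rewrite conj_entry.
- by rewrite rmorph0.
Qed.

(** With [D = 1 - 2P] the matrix is [i] times the block matrix with off-diagonal blocks [D] and
    [-D]. Its square is [D^2] on both diagonal blocks, and [D^2 = 1 + 4 (P^2 - P)]. *)
Lemma callias_sqr p : callias_mx p *m callias_mx p - 1%:M =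
  block_mx (4 *: mx_at (P *m P - P) p) 0 0 (4 *: mx_at (P *m P - P) p).
Proof.
have -> : mx_at (P *m P - P) p = mx_at P p *m mx_at P p - mx_at P p.
  apply/matrixP => a b; rewrite !mxE !fctE fct_sumE.
  by congr (_ - _); apply: eq_bigr => c _; rewrite !mxE.
set Q := mx_at P p.
pose D : 'M[R[i]]_l := 1%:M - 2 *: Q.
have DE : 2 *: Q - 1%:M = - D by rewrite opprB.
have DD : D *m D = 1%:M + 4 *: (Q *m Q - Q).
  rewrite mulmxBl !mulmxBr !mul1mx mulmx1 -scalemxAl -scalemxAr scalerA.
  move: (Q *m Q) => QQ; apply/matrixP => a b; rewrite !mxE.
  by move: (_ *+ _) => d; ring.
rewrite /callias_mx -/Q -/D DE -scalemxAl -scalemxAr scalerA -expr2 sqr_i.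
rewrite mulmx_block !mul0mx !mulmx0 !add0r !addr0 mulmxN mulNmx DD.
rewrite scaleN1r opp_block_mx oppr0 opprK (scalar_mx_block _ _ 1).
by rewrite opp_block_mx add_block_mx !oppr0 !addr0 [1%:M + _]addrC addrK.
Qed.

Lemma callias_sqr_vanishing x y : (forall a b, C0G ((P *m P - P) a b)) ->
  forall e : R, 0 < e -> exists K : set M, cocompact K /\
    forall p, ~ K p -> `|(callias_mx p *m callias_mx p - 1%:M) x y| < e%:C.
Proof.
move=> P0 e e0.
have zero_entry : exists K : set M, cocompact K /\
    forall p, ~ K p -> `|0 : R[i]| < e%:C.
  exists set0; split=> [|p _]; last by rewrite normr0 ltcR.
  by rewrite /cocompact image_set0 closure0; exact: compact0.
have diag_entry a b : exists K : set M, cocompact K /\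
    forall p, ~ K p -> `|(4 *: mx_at (P *m P - P) p) a b| < e%:C.
  have [_ _ /(_ (e / 4))[|K [Kc Ke]]] := P0 a b; first by rewrite divr_gt0.
  exists K; split=> // p /Ke pe; rewrite mxE [mx_at _ _ _ _]mxE normrM.
  rewrite [`|4|]ger0_norm // -ltr_pdivlMl // (lt_le_trans pe) //.
  by rewrite rmorphM fmorphV rmorph_nat mulrC.
case: (split_ordP x) => a ->; case: (split_ordP y) => b ->.
- have [K [Kc Ke]] := diag_entry a b; exists K; split=> // p /Ke.
  by rewrite callias_sqr block_mxEul.
- have [K [Kc Ke]] := zero_entry; exists K; split=> // p /Ke.
  by rewrite callias_sqr block_mxEur mxE.
- have [K [Kc Ke]] := zero_entry; exists K; split=> // p /Ke.
  by rewrite callias_sqr block_mxEdl mxE.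
- have [K [Kc Ke]] := diag_entry a b; exists K; split=> // p /Ke.
  by rewrite callias_sqr block_mxEdr.
Qed.

End CalliasMatrix.


Theorem proposition6p4 (R : realType) (G : lieGroup R) (M : gRiemannian G)
  (hodd : odd (mdim M)) (hcomplete : rcomplete M)
  (hnoncocompact : non_cocompact M)
  (E0 : gClifford M) (l : nat)
  (P0 : 'M[corona_ring M]_l) (hP0 : corona_projection P0)
  (P : 'M[M -> R[i]]_l)
  (hPsmooth : forall i j, CgsmoothG (P i j))
  (hPlift : forall i j, corona_lift (P i j) (P0 i j))
  (hPadj : P = fun_adjmx P)
  (hPidem : forall i j, C0smoothG ((P *m P - P) i j)) :
  g_admissible (E := doubled_bundle E0 l)
    (off_diagonal_op (dirac_op (E := E0))) (callias_endo E0 P).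
Proof.
have P_C1 i j : cfCk 1 setT (P i j) by have [_ PC _] := hPsmooth i j.
pose S := callias_fun_mx P.
have SE x y p : S x y p = callias_mx P p x y by rewrite /S callias_fun_mxE.
(* Moving the scalar ['i] into the matrix entries brings the endomorphism under the abstract
   criterion. *)
have -> : callias_endo E0 P = potential (E0 := E0) S.
  apply: functional_extensionality_dep => p; apply/funext => u.
  rewrite /potential mx_at_callias; apply/ffunP => x; rewrite !ffunE.
  rewrite scaler_sumr; apply: eq_bigr => y _.
  by rewrite scalerA [callias_mx _ _ _ _]mxE.
apply: callias_type_admissible => [x y|x y|x y|p x y|p x y|p x y|x y e e0].
- have [k [a [b [c ->]]]] := callias_affine P x y.
  apply: cfCkD; [exact: openT | exact: cfCk_cst |].
  by apply: cfCkM; [exact: openT | exact: cfCk_cst | exact: P_C1].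
- move=> g p; have [k [a [b [c ->]]]] := callias_affine P x y.
  by have [[_ _ PG] _ _] := hPsmooth b c; rewrite PG.
- have [k [a [b [c ->]]]] := callias_affine P x y.
  by apply: grad_vanishing_affine => //; exact: CgsmoothG_grad_vanishing.
- by rewrite !SE callias_herm.
- by rewrite !SE callias_odd.
- by rewrite !SE callias_swap.
have [K [Kc Ke]] := callias_sqr_vanishing x y (fun a b => (hPidem a b).1) e0.
by exists K; split=> // p /Ke; rewrite /S !mx_at_callias.
Qed.
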